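(* Let $\Delta\subseteq\mathbb{R}_+$ be a countable distance set and let $G=\mathrm{Isom}(\mathbb{U}_\Delta)$. Every continuous irreducible unitary representation of $G$ is (isomorphic to a representation) induced from an irreducible unitary representation of the setwise stabilizer $G_{\{A\}}$, for some finite $A\subseteq\mathbb{U}_\Delta$, which is trivial on the pointwise stabilizer $G_A$. Moreover, every continuous unitary representation of $G$ is a direct sum of irreducible ones.
   Context: A distance set is either a countable additive subsemigroup of the non-negative reals containing $0$, or the intersection $\mathcal{S}\cap[0,r]$ of such a semigroup $\mathcal{S}$ with a bounded interval $[0,r]$, where $r\in\mathcal{S}$. A $\Delta$-metric space is a metric space whose metric takes values in $\Delta$. The Urysohn $\Delta$-metric space $\mathbb{U}_\Delta$ is the unique (up to isometry) countable $\Delta$-metric space which is ultrahomogeneous (every isometry between finite subsets extends to an isometry of $\mathbb{U}_\Delta$ onto itself) and universal (every countable $\Delta$-metric space embeds isometrically into $\mathbb{U}_\Delta$). $\mathrm{Isom}(\mathbb{U}_\Delta)$ is the group of isometries of $\mathbb{U}_\Delta$ onto itself, with the Polish topology of pointwise convergence, $\mathbb{U}_\Delta$ being viewed as a discrete topological space. For $A\subseteq\mathbb{U}_\Delta$ finite, $G_A=\{g\in G: g(a)=a\ \forall a\in A\}$ (pointwise stabilizer) and $G_{\{A\}}=\{g\in G: g(A)=A\}$ (setwise stabilizer). Unitary representations are homomorphisms into the unitary group of a complex Hilbert space (which may be assumed separable), continuous for the strong operator topology. If $H\le G$ is an open subgroup and $\sigma\colon H\to\mathcal{U}(\mathcal{K})$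 is a unitary representation, the induced representation $\mathrm{Ind}_H^G(\sigma)$ is the representation of $G$ by $(\pi(g)f)(x)=f(g^{-1}x)$ on the Hilbert space of maps $f\colon G\to\mathcal{K}$ such that $f(gh)=\sigma(h^{-1})f(g)$ for all $g\in G,h\in H$ and $\sum_{q\in G/H}\|f(q)\|^2<\infty$, where $\|f(q)\|$ is the constant value of $\|f(\cdot)\|$ on the coset $q$. *)

(* Defs.v *)
From HB Require Import structures.
From mathcomp Require Import all_boot all_order all_algebra.
From mathcomp Require Import monoid.
From mathcomp Require Import sesquilinear.
From mathcomp Require Import all_classical all_reals all_analysis.
From mathcomp Require Import complex.

Set Implicit Arguments.
Unset Strict Implicit.
Unset Printing Implicit Defensive.

Import Order.TTheory GRing.Theory Num.Theory.
Import numFieldNormedType.Exports.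

Local Open Scope classical_set_scope.
Local Open Scope ring_scope.

Definition countable_subsemigroup (R : realType) (S : set R) : Prop :=
  [/\ countable S, S `<=` [set x | 0 <= x], S 0 &
      forall x y, S x -> S y -> S (x + y)].

Definition distance_set (R : realType) (Delta : set R) : Prop :=
  exists2 S : set R, countable_subsemigroup S &
    Delta = S \/ (exists2 r, S r & Delta = S `&` `[0, r]).

Definition delta_metric (R : realType) (Delta : set R) (X : metricType R) :
    Prop :=
  forall x y : X, Delta (mdist x y).

Record selfisom (R : realType) (U : metricType R) : Type := Selfisom {
  selfisom_fun :> U -> U ;
  selfisom_dist : forall x y, mdist (selfisom_fun x) (selfisom_fun y) = mdist x y ;
  selfisom_surj : forall y, exists x, selfisom_fun x = y }.

Definition ultrahomogeneous (R : realType) (U : metricType R) : Prop :=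
  forall (A : set U) (f : U -> U), finite_set A ->
    (forall x y, A x -> A y -> mdist (f x) (f y) = mdist x y) ->
    exists g : selfisom U, forall x, A x -> g x = f x.

Definition universal (R : realType) (Delta : set R) (U : metricType R) : Prop :=
  forall X : metricType R, countable [set: X] -> delta_metric Delta X ->
    exists f : X -> U, forall x y, mdist (f x) (f y) = mdist x y.

Definition urysohn (R : realType) (Delta : set R) (U : metricType R) : Prop :=
  [/\ countable [set: U], delta_metric Delta U, ultrahomogeneous U &
      universal Delta U].

Section SelfisomGroup.
Variables (R : realType) (U : metricType R).
Implicit Types g h : selfisom U.

HB.instance Definition _ := gen_eqMixin (selfisom U).
HB.instance Definition _ := gen_choiceMixin (selfisom U).

Lemma selfisomP g h : (forall x, g x = h x) -> g = h.
Proof.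
case: g h => [g g1 g2] [h h1 h2] /= /funext gh; case: _ / gh in h1 h2 *.
by congr Selfisom; exact: Prop_irrelevance.
Qed.

Definition selfisom_one : selfisom U.
Proof. by exists id => // y; exists y. Defined.

Definition selfisom_mul g h : selfisom U.
Proof.
exists (g \o h) => [x y|y] /=; first by rewrite !selfisom_dist.
have [z gz] := selfisom_surj g y; have [x hx] := selfisom_surj h z.
by exists x; rewrite hx.
Defined.

Definition selfisom_invfun g y : U := projT1 (cid (selfisom_surj g y)).

Lemma selfisom_invfunK g : cancel (selfisom_invfun g) g.
Proof. by move=> y; rewrite /selfisom_invfun; case: cid. Qed.

Lemma selfisom_inj g : injective g.
Proof.
move=> x y gxy; apply: (@mdist_positivity R).
by rewrite -(selfisom_dist g) gxy mdistxx.
Qed.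

Lemma selfisom_funK g : cancel g (selfisom_invfun g).
Proof. by move=> x; apply: (@selfisom_inj g); rewrite selfisom_invfunK. Qed.

Definition selfisom_inv g : selfisom U.
Proof.
exists (selfisom_invfun g) => [x y|y].
  by rewrite -(selfisom_dist g) !selfisom_invfunK.
by exists (g y); rewrite selfisom_funK.
Defined.

Fact selfisom_mulA : associative selfisom_mul.
Proof. by move=> f g h; apply: selfisomP. Qed.
Fact selfisom_1mul : left_id selfisom_one selfisom_mul.
Proof. by move=> g; apply: selfisomP. Qed.
Fact selfisom_mul1 : right_id selfisom_one selfisom_mul.
Proof. by move=> g; apply: selfisomP. Qed.
Fact selfisom_Vmul : left_inverse selfisom_one selfisom_inv selfisom_mul.
Proof. by move=> g; apply: selfisomP => x /=; rewrite selfisom_funK. Qed.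
Fact selfisom_mulV : right_inverse selfisom_one selfisom_inv selfisom_mul.
Proof. by move=> g; apply: selfisomP => x /=; rewrite selfisom_invfunK. Qed.

HB.instance Definition _ :=
  isGroup.Build (selfisom U) selfisom_mulA selfisom_1mul selfisom_mul1 selfisom_Vmul selfisom_mulV.

(* Pointwise convergence with U discrete: the metric topology of U plays no
   role here. *)
Definition selfisom_ptws : selfisom U -> {ptws U -> discrete_topology U} :=
  fun g => (g : U -> U).

HB.instance Definition _ :=
  Topological.copy (selfisom U) (initial_topology selfisom_ptws).

Definition pointwise_stabilizer (A : set U) : set (selfisom U) :=
  [set g | forall a, A a -> g a = a].

Definition setwise_stabilizer (A : set U) : set (selfisom U) :=
  [set g | g @` A = A].

End SelfisomGroup.

(* The inner product is linear in its first argument. *)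
HB.mixin Record NormedModule_isHilbert (R : realType) V
    & CompleteNormedModule R[i] V := {
  hdot : {dot V for Num.conj} ;
  hdot_norm : forall v : V, hdot v v = `|v| ^+ 2 }.

#[short(type="hilbertType")]
HB.structure Definition Hilbert (R : realType) :=
  {V of CompleteNormedModule R[i] V & NormedModule_isHilbert R V}.

Definition unitary (R : realType) (V : hilbertType R) (T : V -> V) : Prop :=
  (forall u v, hdot (T u) (T v) = hdot u v) /\ (forall v, exists u, T u = v).

(* Representations of a subgroup D of Isom(U) follow the convention of
   {morphism D >-> rT}: rep_map is total, but only its values on D matter. *)
Record unitary_rep (R : realType) (U : metricType R)
    (D : set (selfisom U)) := UnitaryRep {
  rep_space : hilbertType R ;
  rep_map :> selfisom U -> {linear rep_space -> rep_space} ;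
  rep_unitary : forall g, D g -> unitary (rep_map g) ;
  rep_mul : forall g h, D g -> D h ->
    forall v, rep_map (g * h)%g v = rep_map g (rep_map h v) ;
  rep_continuous : forall v, {within D, continuous (fun g => rep_map g v)} }.

Section Representations.
Variables (R : realType) (U : metricType R).
Implicit Types D : set (selfisom U).

Definition closed_subspace (V : hilbertType R) (W : set V) : Prop :=
  [/\ W 0, forall (a : R[i]) u v, W u -> W v -> W (a *: u + v) & closed W].

Definition invariant_subspace D (pi : unitary_rep D)
    (W : set (rep_space pi)) : Prop :=
  closed_subspace W /\ forall g, D g -> forall v, W v -> W (pi g v).

Definition irreducible D (pi : unitary_rep D) : Prop :=
  (exists v : rep_space pi, v != 0) /\
  forall W : set (rep_space pi), invariant_subspace W ->
    W = [set 0] \/ W = [set: rep_space pi].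

Definition trivial_on D (pi : unitary_rep D) (N : set (selfisom U)) : Prop :=
  forall g, N g -> forall v, pi g v = v.

Definition sqnorm (V : hilbertType R) (v : V) : R := complex.Re `|v| ^+ 2.

Definition left_cosets D : set (set (selfisom U)) :=
  range (fun g => [set (g * h)%g | h in D]).

(* The summand is the constant value of the squared norm of f on q when f is
   equivariant, as it is in ind_space. *)
Definition ind_sqnorm D (sigma : unitary_rep D)
    (f : selfisom U -> rep_space sigma) : \bar R :=
  \esum_(q in left_cosets D) (sqnorm (f (xget 1%g q)))%:E.

Definition ind_space D (sigma : unitary_rep D) :
    set (selfisom U -> rep_space sigma) :=
  [set f | (forall g h, D h -> f (g * h)%g = sigma (h^-1)%g (f g)) /\
           (ind_sqnorm f < +oo)%E].

Arguments ind_space [D] sigma _.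

Definition ind_action D (sigma : unitary_rep D) (g : selfisom U)
    (f : selfisom U -> rep_space sigma) : selfisom U -> rep_space sigma :=
  fun x => f (g^-1 * x)%g.

(* pi is unitarily equivalent to Ind_D^G(sigma), G = Isom(U): there is a
   G-equivariant linear isometry from the space of pi onto ind_space sigma. *)
Definition iso_to_Ind D (sigma : unitary_rep D)
    (pi : unitary_rep [set: selfisom U]) : Prop :=
  exists T : rep_space pi -> (selfisom U -> rep_space sigma),
    [/\ forall (a : R[i]) u v x, T (a *: u + v) x = a *: T u x + T v x,
        range T = ind_space sigma,
        forall v, ind_sqnorm (T v) = (sqnorm v)%:E &
        forall g v, T (pi g v) = ind_action g (T v)].

(* pi is unitarily equivalent to the Hilbert sum of the rho i: families of
   vectors with summable squared norms, under the coordinatewise action. *)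
Definition iso_to_sum D (I : choiceType) (rho : I -> unitary_rep D)
    (pi : unitary_rep D) : Prop :=
  exists T : rep_space pi -> forall i, rep_space (rho i),
    [/\ forall (a : R[i]) u v i, T (a *: u + v) i = a *: T u i + T v i,
        range T = [set w | (\esum_(i in [set: I]) (sqnorm (w i))%:E < +oo)%E],
        forall v, (\esum_(i in [set: I]) (sqnorm (T v i))%:E)%E = (sqnorm v)%:E &
        forall g v i, D g -> T (pi g v) i = rho i g (T v i)].

End Representations.

Arguments ind_space {R U D} sigma _.

(* Main.v *)
Require Import Defs.
From HB Require Import structures.
From mathcomp Require Import all_boot all_order all_algebra.
From mathcomp Require Import monoid sesquilinear.
From mathcomp Require Import all_classical all_reals all_analysis.
From mathcomp Require Import complex.
From mathcomp Require Import ring lra.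

Set Implicit Arguments.
Unset Strict Implicit.
Unset Printing Implicit Defensive.

Import Order.TTheory GRing.Theory Num.Theory.
Import numFieldNormedType.Exports.

Local Open Scope classical_set_scope.
Local Open Scope ring_scope.

(** Let [G = Isom(U)]. For [A] finite, [stab A] is its pointwise stabilizer
    [G_A], [fixed A] the space [H_A] of vectors fixed by [G_A] in a given
    representation, and [P A] the orthogonal projection on [H_A].

    Everything rests on dissociation: if [B] is nonempty, then [P B] maps [H_A]
    into [H_(A ∩ B)] ([proj_fixed_inter]). It has two halves.

    - Averaging. The vector [P B v] is a limit of convex combinations of
      translates of [v] by [G_B]. If [v] is in [H_A], comparing them with a copy
      of [A] amalgamated freely over [B] shows that the norm of [P B v] only
      depends on the numbers [min_(b in B) (d(a, b) + d(b, a'))], for [a] and [a'] in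
      [A] ([sqnorm_proj_free]). These do not change when [B] is replaced by [g B] or
      by [B ∪ g B] with [g] in [G_A]. Hence
      [P_B v = P_(B ∪ gB) v = P_(gB) v = g P_B v], so that [P_B v] lies in both
      [H_A] and [H_B] ([proj_fixed_both]).

    - Generation. [G_A] and [G_B] generate [G_(A ∩ B)] ([stab_inter]), so the
      intersection of [H_A] and [H_B] is [H_(A ∩ B)]. Points are removed one at a
      time; for one point, one connects any two points of the same type over
      a finite set by chains of short steps ([stab_exchange]).

    By continuity the spaces [H_A] have a dense union, so some [H_A] is nonzero.
    If [A] has minimal size with this property, dissociation makes [g H_A]
    orthogonal to [H_A] unless [g A = A] ([exists_dissociated]). In an irreducible
    representation these translates span the whole space, which is therefore
    induced from the action of [G_{A}] on [H_A]. This action is irreducible, since an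
    invariant subspace of [H_A] is the intersection of [H_A] with the closed span of
    its translates ([orbit_span_fixed]).

    For an arbitrary representation, the same is done inside any nonzero
    invariant subspace [W]. The group [G_{A}] acts on [H_A ∩ W] through the
    permutations of [A], a finite group, so there is an irreducible [L] in it, and
    the closed span of the translates of [L] is irreducible
    ([exists_irreducible_subspace]). Zorn's lemma concludes. *)

(** * Closed subspaces as Hilbert spaces *)

(** The proof that [W] is closed is an argument of the type, because completeness
    depends on it. *)
Record subhilbert (R : realType) (V : hilbertType R) (W : set V)
    (hW : closed_subspace W) :=
  SubHilbert { subval : V; subvalP : subval \in W }.

Section SubHilbert.
Variables (R : realType) (V : hilbertType R) (W : set V).
Hypothesis hW : closed_subspace W.
Local Notation S := (subhilbert hW).

HB.instance Definition _ := [isSub for @subval R V W hW].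
HB.instance Definition _ := [Choice of S by <:].

Fact subspace_submod_closed : submod_closed (fun x => x \in W).
Proof.
case: hW => W0 WD _; split=> [|a u v] /=; rewrite -!topredE/=; first exact/mem_set.
by move=> /set_mem Wu /set_mem Wv; apply/mem_set/WD.
Qed.
HB.instance Definition _ :=
  GRing.SubChoice_isSubLmodule.Build _ _ _ S subspace_submod_closed.

Definition subnorm (x : S) : R[i] := `|val x|.
Fact subnormD (x y : S) : subnorm (x + y) <= subnorm x + subnorm y.
Proof. by rewrite /subnorm raddfD ler_normD. Qed.
Fact subnormZ (a : R[i]) (x : S) : subnorm (a *: x) = `|a| * subnorm x.
Proof. by rewrite /subnorm linearZ normrZ. Qed.
Fact subnorm0 (x : S) : subnorm x = 0 -> x = 0.
Proof. by move=> /normr0_eq0 x0; apply: val_inj; rewrite x0 raddf0. Qed.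
HB.instance Definition _ := Lmodule_isNormed.Build R[i] S subnormD subnormZ subnorm0.

Lemma subnormE (x : S) : `|x| = `|val x|. Proof. by []. Qed.

Fact subhilbert_complete (F : set_system S) : ProperFilter F -> cauchy F -> cvg F.
Proof.
move=> FF /cauchy_ballP Fc.
have Fvc : cauchy (val @ F).
  apply/cauchy_ballP => e e0; rewrite !near_simpl.
  have := Fc e e0; apply: filterS => -[x y] /=.
  by rewrite -!ball_normE /= /ball_ /= subnormE raddfB.
have /cvg_ex[/= l Fl] : cvg (val @ F : set_system V) by exact: cauchy_cvg.
have Wl : W l.
  case: hW => _ _; apply.
  move=> A lA; have FA : F (val @^-1` A) := Fl _ lA.
  have [x Ax] := filter_ex FA.
  by exists (val x); split => //; apply/set_mem/subvalP.
apply/cvg_ex => /=; exists (SubHilbert hW (mem_set Wl)).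
apply/cvgrPdist_lt => e e0; have /cvgrPdist_lt/(_ e e0) := Fl.
by rewrite near_simpl.
Qed.
HB.instance Definition _ := Uniform_isComplete.Build S subhilbert_complete.

Definition subdot (x y : S) : R[i] := hdot (val x) (val y).

Fact subdotBl (y : S) : zmod_morphism (subdot ^~ y).
Proof. by move=> u v; rewrite /subdot raddfB linearBl. Qed.
Fact subdotBr (x : S) : zmod_morphism (subdot x).
Proof. by move=> u v; rewrite /subdot raddfB. Qed.
Fact subdotZl (y : S) : scalable_for *%R (subdot ^~ y).
Proof. by move=> a u; rewrite /subdot linearZ /= linearZl_LR. Qed.
Fact subdotZr (x : S) : scalable_for (Num.conj \; *%R) (subdot x).
Proof. by move=> a u; rewrite /subdot linearZ. Qed.
HB.instance Definition _ :=
  isBilinear.Build R[i] S S R[i] *%R (Num.conj \; *%R) subdot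
    subdotBl subdotBr subdotZl subdotZr.
Fact subdot_herm (x y : S) : subdot x y = (-1) ^+ false * Num.conj (subdot y x).
Proof. by rewrite /subdot hermC. Qed.
HB.instance Definition _ :=
  isHermitianSesquilinear.Build R[i] S false Num.conj subdot subdot_herm.
Fact subdot_gt0 (u : S) : u != 0 -> 0 < subdot u u.
Proof.
by move=> u0; apply: neq0_dnorm_gt0; apply: contra_neq u0 => u0; apply: val_inj.
Qed.
HB.instance Definition _ := isDotProduct.Build R[i] S subdot subdot_gt0.
Fact subdot_norm (v : S) : subdot v v = `|v| ^+ 2.
Proof. exact: hdot_norm. Qed.
HB.instance Definition _ :=
  NormedModule_isHilbert.Build R S subdot_norm.

End SubHilbert.

Local Notation "x %:C" := (real_complex _ x) (format "x %:C") : ring_scope.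

(** * Geometry of Hilbert space *)

Section HilbertGeometry.
Variables (R : realType) (V : hilbertType R).
Implicit Types (u v w : V) (X W : set V).

(** The real part of the inner product. All subspaces below are complex, so
    being orthogonal to one of them has the same meaning for [ip] and for [hdot];
    working with [ip] keeps the computations over an ordered field. *)
Definition ip u v : R := complex.Re (hdot u v).
Definition nrm v : R := complex.Re `|v|.

Lemma normE v : `|v| = (nrm v)%:C.
Proof. by rewrite /nrm RRe_real// ger0_real. Qed.

Lemma nrm_ge0 v : 0 <= nrm v.
Proof. by have := normr_ge0 v; rewrite normE ler0c. Qed.

Lemma sqnormE v : sqnorm v = nrm v ^+ 2. Proof. by []. Qed.

Lemma ip_sqnorm v : ip v v = sqnorm v.
Proof.
by rewrite /ip hdot_norm normE sqnormE -(rmorphXn (real_complex R)).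
Qed.

Lemma sqnorm_ge0 v : 0 <= sqnorm v. Proof. exact: sqr_ge0. Qed.

Lemma nrm0 : nrm 0 = 0. Proof. by rewrite /nrm normr0. Qed.

Lemma nrm_eq0 v : nrm v = 0 -> v = 0.
Proof. by move=> v0; apply: (@normr0_eq0 _ V); rewrite normE v0. Qed.

Lemma sqnorm_eq0 v : sqnorm v = 0 -> v = 0.
Proof. by move/eqP; rewrite expf_eq0 /= => /eqP/nrm_eq0. Qed.

Lemma nrmD u v : nrm (u + v) <= nrm u + nrm v.
Proof. by have := ler_normD u v; rewrite !normE -rmorphD lecR. Qed.

Lemma nrmN v : nrm (- v) = nrm v.
Proof. by rewrite /nrm normrN. Qed.

Lemma nrmB u v : nrm (u - v) = nrm (v - u).
Proof. by rewrite -nrmN opprB. Qed.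

Lemma sqnormN v : sqnorm (- v) = sqnorm v.
Proof. by rewrite !sqnormE nrmN. Qed.

Lemma ReD (x y : R[i]) : complex.Re (x + y) = complex.Re x + complex.Re y.
Proof. by case: x y => [a b] [c d]. Qed.

Lemma ReN (x : R[i]) : complex.Re (- x) = - complex.Re x.
Proof. by case: x. Qed.

Lemma ReZ (c : R) (x : R[i]) : complex.Re (c%:C * x) = c * complex.Re x.
Proof. by case: x => a b /=; rewrite mul0r subr0. Qed.

Lemma ipC u v : ip u v = ip v u.
Proof.
rewrite /ip hermC /= expr0 mul1r.
by case: (hdot v u).
Qed.

Lemma ipDl u v w : ip (u + v) w = ip u w + ip v w.
Proof. by rewrite /ip linearDl ReD. Qed.

Lemma ipDr u v w : ip u (v + w) = ip u v + ip u w.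
Proof. by rewrite !(ipC u) ipDl. Qed.

Lemma ipNl u v : ip (- u) v = - ip u v.
Proof. by rewrite /ip linearNl ReN. Qed.

Lemma ipNr u v : ip u (- v) = - ip u v.
Proof. by rewrite !(ipC u) ipNl. Qed.

Lemma ipBl u v w : ip (u - v) w = ip u w - ip v w.
Proof. by rewrite ipDl ipNl. Qed.

Lemma ipBr u v w : ip u (v - w) = ip u v - ip u w.
Proof. by rewrite ipDr ipNr. Qed.

Lemma ip0l v : ip 0 v = 0. Proof. by rewrite -(subrr 0) ipBl subrr. Qed.
Lemma ip0r v : ip v 0 = 0. Proof. by rewrite ipC ip0l. Qed.

Lemma ipZl (c : R) u v : ip (c%:C *: u) v = c * ip u v.
Proof.
by rewrite /ip linearZl_LR /= ReZ.
Qed.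

Lemma ipZr (c : R) u v : ip u (c%:C *: v) = c * ip u v.
Proof. by rewrite ipC ipZl ipC. Qed.

Lemma ip_adj (a : R[i]) u v : ip (a *: u) v = ip u (Num.conj a *: v).
Proof.
rewrite /ip linearZl_LR linearZr_LR /=; congr (complex.Re (_ * _)).
by rewrite conjCK.
Qed.

Lemma sqnormD u v : sqnorm (u + v) = sqnorm u + sqnorm v + 2 * ip u v.
Proof. by rewrite -!ip_sqnorm ipDl !ipDr (ipC v u); lra. Qed.

Lemma sqnormB u v : sqnorm (u - v) = sqnorm u + sqnorm v - 2 * ip u v.
Proof. by rewrite sqnormD sqnormN ipNr mulrN. Qed.

Lemma cauchy_schwarz u v : ip u v <= nrm u * nrm v.
Proof.
have [u0|/eqP u0] := eqVneq (nrm u) 0.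
  by rewrite (nrm_eq0 u0) ip0l nrm0 mul0r.
have [v0|/eqP v0] := eqVneq (nrm v) 0.
  by rewrite (nrm_eq0 v0) ip0r nrm0 mulr0.
have a0 : 0 < nrm u by rewrite lt_neqAle nrm_ge0 eq_sym andbT; apply/eqP.
have b0 : 0 < nrm v by rewrite lt_neqAle nrm_ge0 eq_sym andbT; apply/eqP.
have := sqnorm_ge0 ((nrm v)%:C *: u - (nrm u)%:C *: v).
rewrite sqnormB -!ip_sqnorm !(ipZl, ipZr) !ip_sqnorm !sqnormE.
rewrite (_ : _ - _ = 2 * (nrm u * nrm v) * (nrm u * nrm v - ip u v)); last by ring.
rewrite pmulr_rge0 ?subr_ge0//.
by rewrite !mulr_gt0.
Qed.

Lemma ler_norm_ip u v : `|ip u v| <= nrm u * nrm v.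
Proof. by rewrite ler_norml lerNl -ipNl -{1}nrmN !cauchy_schwarz. Qed.

Definition mid u v : V := (2^-1)%:C *: (u + v).

Lemma mid_ip u v w : ip (mid u v) w = 2^-1 * (ip u w + ip v w).
Proof. by rewrite /mid ipZl ipDl. Qed.

Lemma nrm_mid u v : nrm (mid u v) <= 2^-1 * (nrm u + nrm v).
Proof.
have h : `|(2^-1)%:C : R[i]| = (2^-1)%:C by rewrite ger0_norm// ler0c invr_ge0.
rewrite /nrm normrZ h ReZ.
by rewrite ler_wpM2l ?invr_ge0// nrmD.
Qed.

Lemma parallelogram u v :
  sqnorm (u - v) = 2 * sqnorm u + 2 * sqnorm v - 4 * sqnorm (mid u v).
Proof.
by rewrite sqnormB -(ip_sqnorm (mid u v)) /mid ipZl ipZr ip_sqnorm sqnormD; lra.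
Qed.

Lemma midB u v w : mid u v - w = mid (u - w) (v - w).
Proof.
rewrite /mid addrACA -opprD scalerBr; congr (_ - _).
rewrite -[w in w + w]scale1r -scalerDl scalerA.
have -> : (1 + 1 : R[i]) = 2%:C by rewrite -(rmorphD (real_complex R)).
by rewrite -rmorphM mulVf ?pnatr_eq0// scale1r.
Qed.

Lemma midN u v : mid (- u) (- v) = - mid u v.
Proof. by rewrite /mid -opprD scalerN. Qed.

Definition adherent X u := forall e : R, 0 < e -> exists2 w, X w & nrm (w - u) < e.

Lemma closedP X : closed X <-> forall u, adherent X u -> X u.
Proof.
split=> [cX u Xu|h u clu].
  apply: cX => A /nbhs_ballP[e /= e0 eA].
  have e0' : 0 < complex.Re e by move: e0; rewrite ltcE => /andP[].
  have [w Xw wu] := Xu _ e0'.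
  exists w; split => //; apply: eA; rewrite -ball_normE /ball_ /= distrC normE.
  have er : e = (complex.Re e)%:C by rewrite RRe_real// gtr0_real.
  by rewrite er ltcR.
apply: h => e e0.
have : nbhs u (ball u e%:C).
  by apply: nbhsx_ballx; rewrite ltcR.
move=> /clu[w [Xw]]; rewrite -ball_normE /ball_ /= distrC normE ltcR => wu.
by exists w.
Qed.

Lemma cauchy_seq_cvg (w : nat -> V) :
  (forall e : R, 0 < e -> exists N, forall n k, (N <= n)%N -> (N <= k)%N ->
    nrm (w n - w k) < e) ->
  exists l, forall e : R, 0 < e -> exists N, forall n, (N <= n)%N ->
    nrm (w n - l) < e.
Proof.
move=> wC.
have : cvg (w @ \oo : set_system V).
  apply: cauchy_cvg; apply: cauchy_exP => e e0.
  have e0' : 0 < complex.Re e by move: e0; rewrite ltcE => /andP[].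
  have er : e = (complex.Re e)%:C by rewrite RRe_real// gtr0_real.
  have [N Nw] := wC _ e0'.
  exists (w N); exists N => // n /= Nn; rewrite -ball_normE /ball_ /=.
  by rewrite normE er ltcR; exact: Nw.
move=> /cvg_ex[l /cvgrPdist_lt wl]; exists l => e e0.
have e0' : 0 < e%:C by rewrite ltcR.
have [N _ Nw] := wl _ e0'; exists N => n Nn.
by rewrite nrmB; have := Nw n Nn; rewrite /= normE ltcR.
Qed.

Lemma inv_lt_sqr (e : R) : 0 < e ->
  exists N : nat, forall n, (N <= n)%N -> n.+1%:R^-1 < e ^+ 2.
Proof.
move=> e0; have [N] := ltr_add_invr (exprn_gt0 2 e0 : 0 < e ^+ 2).
rewrite add0r => Ne; exists N => n Nn; apply: le_lt_trans Ne.
by rewrite lef_pV2 ?posrE// ler_nat ltnS.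
Qed.

Lemma nrm_lt v (e : R) : 0 < e -> sqnorm v < e ^+ 2 -> nrm v < e.
Proof. by move=> e0; rewrite sqnormE ltr_pXn2r// ?nnegrE ?nrm_ge0//; exact: ltW. Qed.

Lemma adherent_nrm_le X u (c : R) :
  adherent X u -> (forall w, X w -> nrm w <= c) -> nrm u <= c.
Proof.
move=> Xu Xc; apply/ler_addgt0Pr => e e0; have [w Xw wu] := Xu _ e0.
rewrite -(subrK w u) addrC; apply: (le_trans (nrmD _ _)).
by rewrite lerD ?Xc// nrmB ltW.
Qed.

(** Midpoint convexity is enough: by the parallelogram law a minimizing sequence
    in [X] is Cauchy, and two minimizing adherent points are at distance 0. The
    two uses are the projection on a closed subspace and the fixed vector in the
    closed convex hull of an orbit. *)
Lemma min_norm_point X : X !=set0 ->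
  (forall u v, X u -> X v -> X (mid u v)) ->
  exists u, [/\ adherent X u, forall w, X w -> nrm u <= nrm w &
    forall v, adherent X v -> nrm v <= nrm u -> v = u].
Proof.
move=> [x0 Xx0] Xmid.
pose m := inf (@sqnorm R V @` X).
have hinf : has_inf (@sqnorm R V @` X).
  by split; [exists (sqnorm x0), x0|exists 0 => _ [x _ <-]; exact: sqnorm_ge0].
have m_le w : X w -> m <= sqnorm w.
  by move=> Xw; apply: ge_inf; [case: hinf|exists w].
have m0 : 0 <= m.
  by apply: lb_le_inf; [case: hinf|move=> _ [x _ <-]; exact: sqnorm_ge0].
have close u v (e : R) : X u -> X v -> sqnorm u < m + e -> sqnorm v < m + e ->
    sqnorm (u - v) < 4 * e.
  by move=> Xu Xv ue ve; rewrite parallelogram; have := m_le _ (Xmid _ _ Xu Xv); lra.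
have /choice[w hw] (n : nat) : exists w, X w /\ sqnorm w < m + n.+1%:R^-1.
  have n0 : 0 < n.+1%:R^-1 :> R by rewrite invr_gt0.
  by have [_ [w Xw <-] wn] := inf_adherent n0 hinf; exists w.
have tail (n N : nat) : (N <= n)%N -> sqnorm (w n) < m + N.+1%:R^-1.
  move=> Nn; apply: (lt_le_trans (hw n).2); rewrite lerD2l lef_pV2 ?posrE//.
  by rewrite ler_nat ltnS.
have [e e0|u wu] := cauchy_seq_cvg (w := w).
  have e2 : 0 < e / 2 by rewrite divr_gt0.
  have [N /(_ N (leqnn _)) Ne] := inv_lt_sqr e2; exists N => n k Nn Nk.
  apply: nrm_lt => //; have := close _ _ _ (hw n).1 (hw k).1 (tail _ _ Nn) (tail _ _ Nk).
  move=> /lt_trans; apply; move: Ne; rewrite expr_div_n.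
  by move: (N.+1%:R^-1) (e ^+ 2) => a b; lra.
have Xu : adherent X u.
  move=> e e0; have [N Nw] := wu _ e0.
  by exists (w N); [exact: (hw _).1|exact: Nw].
have um : nrm u <= Num.sqrt m.
  suff ume (e : R) : 0 < e -> nrm u <= Num.sqrt m + e by apply/ler_addgt0Pr.
  move=> e0.
  have [k /(_ k (leqnn _)) ke] := inv_lt_sqr e0.
  pose Y := [set x | nrm x <= Num.sqrt m + e].
  apply: (@adherent_nrm_le Y) => // d d0.
  have [N Nw] := wu _ d0; exists (w (maxn N k)); last by rewrite Nw ?leq_maxl.
  have := tail _ _ (leq_maxr N k); rewrite /Y /= sqnormE => wm.
  have s0 := sqrtr_ge0 m.
  rewrite -(@ler_pXn2r _ 2) ?nnegrE ?nrm_ge0 ?addr_ge0 ?(ltW e0)//.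
  have k0 : 0 < k.+1%:R^-1 :> R by rewrite invr_gt0.
  apply: (le_trans (ltW wm)); rewrite sqrrD sqr_sqrtr// -addrA lerD2l.
  have := mulr_ge0 s0 (ltW e0); rewrite mulr2n.
  move: ke k0; move: (Num.sqrt m * e) (k.+1%:R^-1) (e ^+ 2) => a b c; lra.
have mu y : adherent X y -> Num.sqrt m <= nrm y.
  move=> Xy; apply/ler_addgt0Pr => e e0; have [x Xx xy] := Xy _ e0.
  have : Num.sqrt m <= nrm x.
    by rewrite -(ger0_norm (nrm_ge0 x)) -sqrtr_sqr ler_wsqrtr// m_le.
  move=> /le_trans; apply; rewrite -(subrK y x) addrC.
  by apply: (le_trans (nrmD _ _)); rewrite lerD2l ltW.
have sqE y : adherent X y -> nrm y <= nrm u -> sqnorm y = m.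
  move=> Xy yu; rewrite sqnormE.
  have -> : nrm y = Num.sqrt m.
    by apply/eqP; rewrite eq_le mu// andbT (le_trans yu).
  by rewrite sqr_sqrtr.
exists u; split=> // [x Xx|v Xv vu].
  apply: (le_trans um); apply: mu => e e0; exists x => //.
  by rewrite subrr nrm0.
have Xm : adherent X (mid v u).
  move=> e e0; have [x Xx xv] := Xv _ e0; have [y Xy yu] := Xu _ e0.
  exists (mid x y); first exact: Xmid.
  have -> : mid x y - mid v u = mid (x - v) (y - u).
    by rewrite /mid -scalerBr opprD addrACA.
  by apply: (le_lt_trans (nrm_mid _ _)); lra.
apply/eqP; rewrite -subr_eq0; apply/eqP/sqnorm_eq0/eqP.
rewrite eq_le sqnorm_ge0 andbT parallelogram (sqE v)// (sqE u)//.
have : m <= sqnorm (mid v u).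
  have := mu _ Xm; rewrite sqnormE => h; rewrite -(sqr_sqrtr m0); move: h.
  by rewrite ler_pXn2r ?nnegrE ?nrm_ge0 ?sqrtr_ge0.
lra.
Qed.

Lemma adherent_ip X u y (c : R) :
  adherent X u -> (forall w, X w -> ip w y = c) -> ip u y = c.
Proof.
move=> Xu Xc; apply/eqP; rewrite -subr_eq0 -normr_le0.
suff h (e : R) : 0 < e -> `|ip u y - c| <= e.
  by apply/ler_addgt0Pr => e e0; rewrite add0r h.
move=> e0; have y1 : 0 < nrm y + 1 by rewrite ltr_wpDl ?nrm_ge0.
have [w Xw wu] := Xu _ (divr_gt0 e0 y1).
rewrite -(Xc _ Xw) -ipBl; apply: (le_trans (ler_norm_ip _ _)).
move: wu; rewrite nrmB ltr_pdivlMr// mulrDr mulr1 => wu.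
by have := nrm_ge0 (u - w); lra.
Qed.

(** The point of minimal norm of [v - W] is orthogonal to [W], because moving it
    along [W] cannot make it shorter. *)
Lemma proj_exists W v : closed_subspace W ->
  exists w, W w /\ forall x, W x -> ip (v - w) x = 0.
Proof.
move=> [W0 WD Wc].
have WD' u x : W u -> W x -> W (u + x).
  by move=> Wu Wx; rewrite -[u]scale1r; exact: WD.
have WZ a u : W u -> W (a *: u) by move=> Wu; rewrite -[_ *: _]addr0; exact: WD.
have [||u [Xu umin _]] := @min_norm_point [set v - w | w in W].
- by exists (v - 0), 0.
- move=> _ _ [x Wx <-] [y Wy <-]; exists (mid x y); first exact/WZ/WD'.
  by rewrite -opprB midB -midN !opprB.
have Wvu : W (v - u).
  move/closedP : Wc; apply => e /Xu[_ [w Ww <-]]; exists w => //.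
  by rewrite nrmB (_ : v - u - w = v - w - u)// addrAC.
exists (v - u); split=> // x Wx; rewrite subKr.
have [x0|/eqP x0] := eqVneq (sqnorm x) 0; first by rewrite (sqnorm_eq0 x0) ip0r.
(* t minimizes the norm of u - t x *)
pose t := ip u x / sqnorm x.
have Xt : [set v - w | w in W] (u - t%:C *: x).
  exists (v - u + t%:C *: x); first exact/WD'/WZ.
  by rewrite opprD addrA subKr.
have xp : 0 < sqnorm x by rewrite lt_neqAle sqnorm_ge0 andbT eq_sym; apply/eqP.
have : sqnorm u <= sqnorm (u - t%:C *: x).
  by rewrite ler_pXn2r ?nnegrE ?nrm_ge0//; exact: umin.
rewrite sqnormB -(ip_sqnorm (_ *: _)) !(ipZl, ipZr) ip_sqnorm.
rewrite (_ : _ - _ = sqnorm u - ip u x ^+ 2 / sqnorm x); last first.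
  by rewrite /t; field; rewrite gt_eqF.
rewrite lerBrDr gerDl pmulr_lle0 ?invr_gt0// => h.
have : ip u x ^+ 2 == 0 by rewrite eq_le h sqr_ge0.
by rewrite expf_eq0 => /eqP.
Qed.

Definition is_proj W v w := W w /\ forall x, W x -> ip (v - w) x = 0.
Definition proj W v : V := xget 0 [set w | is_proj W v w].

Section Subspace.
Variable W : set V.
Hypothesis hW : closed_subspace W.

Lemma subspace0 : W 0. Proof. by case: hW. Qed.
Lemma subspaceL (a : R[i]) u v : W u -> W v -> W (a *: u + v).
Proof. by case: hW => _ h _; exact: h. Qed.
Lemma subspaceZ (a : R[i]) u : W u -> W (a *: u).
Proof. by move=> Wu; rewrite -[_ *: _]addr0; apply: subspaceL => //; exact: subspace0. Qed.
Lemma subspaceD u v : W u -> W v -> W (u + v).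
Proof. by move=> Wu Wv; rewrite -[u]scale1r; exact: subspaceL. Qed.
Lemma subspaceB u v : W u -> W v -> W (u - v).
Proof. by move=> Wu Wv; rewrite addrC -scaleN1r; exact: subspaceL. Qed.

Lemma projP v : is_proj W v (proj W v).
Proof. by have [w hw] := proj_exists v hW; exact: (@xgetI _ 0 (is_proj W v) w hw). Qed.

Lemma proj_in v : W (proj W v). Proof. by case: (projP v). Qed.

Lemma proj_ipl v x : W x -> ip (proj W v) x = ip v x.
Proof.
by move=> Wx; apply/eqP; rewrite -subr_eq0 -opprB oppr_eq0 -ipBl (projP v).2.
Qed.

Lemma proj_eq v w : W w -> (forall x, W x -> ip w x = ip v x) -> proj W v = w.
Proof.
move=> Ww wv; apply/eqP; rewrite -subr_eq0; apply/eqP/sqnorm_eq0.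
have Wd : W (proj W v - w) by apply: subspaceB => //; exact: proj_in.
by rewrite -ip_sqnorm ipBl proj_ipl// wv// subrr.
Qed.

Lemma proj_id v : W v -> proj W v = v.
Proof. by move=> Wv; apply: proj_eq. Qed.

Lemma proj_ip u v : ip (proj W u) v = ip u (proj W v).
Proof.
by rewrite -(proj_ipl u (proj_in v)) ![ip (proj W u) _]ipC proj_ipl//; exact: proj_in.
Qed.

Lemma proj_linear (a : R[i]) u v : proj W (a *: u + v) = a *: proj W u + proj W v.
Proof.
apply: proj_eq => [|x Wx]; first by apply: subspaceL; exact: proj_in.
by rewrite !ipDl !ip_adj proj_ip proj_id ?proj_ip ?(proj_id Wx)//; exact: subspaceZ.
Qed.

Lemma sqnorm_proj v : sqnorm v = sqnorm (proj W v) + sqnorm (v - proj W v).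
Proof.
have := sqnormD (v - proj W v) (proj W v).
by rewrite subrK (projP v).2 ?mulr0 ?addr0 1?addrC//; exact: proj_in.
Qed.

Lemma sqnorm_proj_le v : sqnorm (proj W v) <= sqnorm v.
Proof. by rewrite [leRHS]sqnorm_proj lerDl sqnorm_ge0. Qed.

Lemma sqnorm_proj_id v : sqnorm (proj W v) = sqnorm v -> proj W v = v.
Proof.
rewrite [RHS]sqnorm_proj => /eqP; rewrite -subr_eq0 opprD addNKr oppr_eq0.
by move=> /eqP/sqnorm_eq0/eqP; rewrite subr_eq0 => /eqP.
Qed.

End Subspace.

Lemma proj_comp W1 W2 v : closed_subspace W1 -> closed_subspace W2 -> W1 `<=` W2 ->
  proj W1 (proj W2 v) = proj W1 v.
Proof.
move=> h1 h2 h12; apply: (proj_eq h1) => [|x W1x]; first exact: proj_in.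
by rewrite proj_ipl// proj_ipl//; exact: h12.
Qed.

(** The scalar [a] makes this the orthogonal for the complex inner product. *)
Definition perp X : set V := [set v | forall x a, X x -> ip v (a *: x) = 0].

Lemma perp_closed X : closed_subspace (perp X).
Proof.
split=> [x a _|a u v hu hv x b Xx|]; first by rewrite ip0l.
  by rewrite ipDl ip_adj scalerA hu// hv// addr0.
apply/closedP => u hu x a Xx; apply: (adherent_ip hu) => w hw.
exact: hw.
Qed.

Lemma perp_ip X u x : perp X u -> X x -> ip u x = 0.
Proof. by move=> hu Xx; rewrite -[x]scale1r hu. Qed.

(** The closed linear span, in the form of a double orthogonal. *)
Definition cspan X := perp (perp X).

Lemma cspan_closed X : closed_subspace (cspan X). Proof. exact: perp_closed. Qed.

Lemma sub_cspan X : X `<=` cspan X.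
Proof. by move=> x Xx y a hy; rewrite ipC ip_adj hy. Qed.

Lemma cspan_min X W : closed_subspace W -> X `<=` W -> cspan X `<=` W.
Proof.
move=> hW XW v hv; suff <- : proj W v = v by exact: proj_in.
have hd : perp X (v - proj W v).
  by move=> x a Xx; apply: (projP hW v).2; apply: subspaceZ => //; exact: XW.
apply/eqP; rewrite eq_sym -subr_eq0; apply/eqP/sqnorm_eq0.
rewrite -ip_sqnorm ipBl (perp_ip hv hd) ipC (projP hW v).2 ?subrr//.
exact: proj_in.
Qed.

End HilbertGeometry.

(** * Distance sets *)

(** The truncation [cap] is what makes the two kinds of distance sets uniform: it
    is the identity for a semigroup, and [min r] for the intersection of a
    semigroup with [[0, r]]. Then [cap (x + y)] is the sum in the distance set. *)
Definition truncation (R : realType) (Delta : set R) (cap : R -> R) : Prop :=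
  [/\ forall x y, Delta x -> Delta y -> Delta (cap (x + y)),
      forall x y, Delta y -> x <= y -> cap x = x,
      {homo cap : x y / x <= y} &
      forall x y, 0 <= x -> 0 <= y -> cap (x + y) <= cap x + cap y].

Section Cap.
Variables (R : realType) (Delta : set R).

Lemma truncation_exists : distance_set Delta -> exists cap, truncation Delta cap.
Proof.
move=> [S [_ S0 _ SD] [->|[r Sr ->]]].
  by exists id; split.
exists (Num.min r); split=> [x y [Sx _] [Sy _]|x y [_ /=]|x y xy|x y x0 y0].
- split; first by rewrite /Num.min; case: ifP => // _; exact: SD.
  by rewrite /= in_itv /= ge_min lexx le_min (S0 _ Sr) addr_ge0 ?S0.
- by rewrite in_itv /= => /andP[_ yr] xy; apply: min_r; exact: le_trans yr.
- by rewrite le_min ge_min lexx /= ge_min xy orbT.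
have r0 : 0 <= r := S0 _ Sr.
by rewrite /Num.min; do 3 case: ltP => ?; lra.
Qed.

Lemma distance_set_ge0 x : distance_set Delta -> Delta x -> 0 <= x.
Proof. by move=> [S [_ S0 _ _] [->|[r _ ->]]]; [exact: S0|move=> [/S0]]. Qed.

Lemma distance_set0 : distance_set Delta -> Delta 0.
Proof.
move=> [S [_ S0 S00 _] [->//|[r Sr ->]]]; split => //=.
by rewrite in_itv /= lexx S0.
Qed.

Lemma distance_set_double d y k : distance_set Delta -> Delta d -> Delta y ->
  2 ^+ k * d <= y -> Delta (2 ^+ k * d).
Proof.
move=> hD Dd Dy; have [cap [capD capid _ _]] := truncation_exists hD.
have d0 := distance_set_ge0 hD Dd.
elim: k => [|k IH]; first by rewrite expr0 mul1r.
rewrite exprS -mulrA => ky.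
have k0 : 0 <= 2 ^+ k * d by rewrite mulr_ge0// exprn_ge0.
have Dk : Delta (2 ^+ k * d) by apply: IH; lra.
rewrite -(capid _ _ Dy ky) (_ : 2 * _ = 2 ^+ k * d + 2 ^+ k * d); last by ring.
exact: capD.
Qed.

End Cap.

(** * One-point extensions in the Urysohn space *)

(** The hypotheses are arguments of the type so that its metric can be found from
    the type alone. *)
Definition one_point_ext (R : realType) (U : metricType R) (s : seq U) (f : U -> R)
   (f0 : forall x, x \in s -> 0 < f x)
   (f1 : forall x y, x \in s -> y \in s -> f x <= mdist x y + f y)
   (f2 : forall x y, x \in s -> y \in s -> mdist x y <= f x + f y) : Type :=
  option (seq_sub s).

Section OnePoint.
Variables (R : realType) (U : metricType R) (s : seq U) (f : U -> R).
Hypothesis f0 : forall x, x \in s -> 0 < f x.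
Hypothesis f1 : forall x y, x \in s -> y \in s -> f x <= mdist x y + f y.
Hypothesis f2 : forall x y, x \in s -> y \in s -> mdist x y <= f x + f y.
Local Notation T := (one_point_ext f0 f1 f2).

HB.instance Definition _ := Countable.copy T (option (seq_sub s)).

Definition one_point_dist (a b : T) : R :=
  match a, b with
  | Some x, Some y => mdist (val x) (val y)
  | Some x, None | None, Some x => f (val x)
  | None, None => 0
  end.

Fact one_point_distxx a : one_point_dist a a = 0.
Proof. by case: a => //= x; rewrite mdistxx. Qed.
Fact one_point_dist_pos a b : one_point_dist a b = 0 -> a = b.
Proof.
case: a b => [x|] [y|] //=.
- by move=> /mdist_positivity/val_inj ->.
- by have := f0 (valP x) => /[swap] ->; rewrite ltxx.
- by have := f0 (valP y) => /[swap] ->; rewrite ltxx.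
Qed.
Fact one_point_dist_sym a b : one_point_dist a b = one_point_dist b a.
Proof. by case: a b => [x|] [y|] //=; rewrite metric_sym. Qed.
Fact one_point_dist_tri b a c :
  one_point_dist a c <= one_point_dist a b + one_point_dist b c.
Proof.
case: a b c => [x|] [y|] [z|] //=; rewrite ?addr0 ?add0r //.
- exact: metric_triangle.
- exact/f1/valP/valP.
- exact/f2/valP/valP.
- by rewrite addrC metric_sym; exact/f1/valP/valP.
- by apply: addr_ge0; exact/ltW/f0/valP.
Qed.
HB.instance Definition _ := isMetric.Build R T one_point_distxx one_point_dist_pos
  one_point_dist_sym one_point_dist_tri.
Lemma mdist_one_point (a b : T) : mdist a b = one_point_dist a b.
Proof. by []. Qed.

End OnePoint.

Section Urysohn.
Variables (R : realType) (Delta : set R) (U : metricType R).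
Hypotheses (hDelta : distance_set Delta) (hU : urysohn Delta U).

(** Ultrahomogeneity for indexed families: an isometry between two finite
    families is well defined on points since points at distance 0 coincide. *)
Lemma homogeneity (I : eqType) (s : seq I) (p q : I -> U) :
  (forall i j, i \in s -> j \in s -> mdist (p i) (p j) = mdist (q i) (q j)) ->
  exists g : selfisom U, forall i, i \in s -> g (p i) = q i.
Proof.
move=> pq; have [_ _ hom _] := hU.
pose P x y := exists i, [/\ i \in s, p i = x & q i = y].
have /choice[f hf] (x : U) : exists y, (exists i, i \in s /\ p i = x) -> P x y.
  have [[i [si <-]]|h] := pselect (exists i, i \in s /\ p i = x).
    by exists (q i) => _; exists i.
  by exists x => /h.
have fp i : i \in s -> f (p i) = q i.
  move=> si; have [|j [sj pji <-]] := hf (p i); first by exists i.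
  by apply: (@mdist_positivity R); rewrite -pq// pji mdistxx.
have [|x y|g gf] := hom [set x | x \in map p s] f.
- exact: finite_seq.
- move=> /= /mapP[i si ->] /mapP[j sj ->].
  by rewrite !fp// pq.
by exists g => i si; rewrite gf ?fp//=; apply: map_f.
Qed.

(** Universality embeds the abstract one-point extension of [s] by [f] in [U], and
    homogeneity moves the copy of [s] so obtained back onto [s]. *)
Lemma extension (s : seq U) (f : U -> R) :
  (forall x, x \in s -> Delta (f x)) ->
  (forall x y, x \in s -> y \in s -> f x <= mdist x y + f y) ->
  (forall x y, x \in s -> y \in s -> mdist x y <= f x + f y) ->
  exists z, forall x, x \in s -> mdist z x = f x.
Proof.
move=> Df f1 f2.
have fge x : x \in s -> 0 <= f x by move=> /Df; exact: distance_set_ge0.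
have [/hasP[x sx /eqP fx0]|/hasPn h] := boolP (has (fun x => f x == 0) s).
  (* where f vanishes the new point is an old one *)
  exists x => y sy; apply/eqP; rewrite eq_le; apply/andP; split.
    by have := f2 _ _ sx sy; rewrite fx0 add0r.
  by have := f1 _ _ sy sx; rewrite fx0 addr0 metric_sym.
have f0 x : x \in s -> 0 < f x by move=> sx; rewrite lt_neqAle fge// eq_sym h.
have [_ DU _ univ] := hU.
pose T : metricType R := one_point_ext f0 f1 f2.
have [| |phi hphi] := univ T.
- exact: countableP.
- move=> [x|] [y|]; rewrite mdist_one_point //=; try exact/Df/valP.
  exact: distance_set0.
pose p (x : U) := phi (insub x : option (seq_sub s)).
have hin x (sx : x \in s) : (insub x : option (seq_sub s)) = Some (SeqSub sx).
  exact: insubT.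
have [x y sx sy|g hg] := @homogeneity U s p id.
  by rewrite [LHS]hphi mdist_one_point !hin.
exists (g (phi None)) => x sx.
by rewrite -{1}(hg _ sx) selfisom_dist [LHS]hphi mdist_one_point hin.
Qed.

End Urysohn.

(** * Pointwise stabilizers of finite sets *)

Section Stab.
Variables (R : realType) (U : metricType R).
Implicit Types (g h : selfisom U) (A B E F : seq U).

Definition stab A : set (selfisom U) := [set g | forall a, a \in A -> g a = a].

Lemma selfisom1E (x : U) : (1%g : selfisom U) x = x. Proof. by []. Qed.
Lemma selfisomME g h x : (g * h)%g x = g (h x). Proof. by []. Qed.
Lemma selfisomVK g x : (g^-1)%g (g x) = x.
Proof. by rewrite -selfisomME mulVg. Qed.
Lemma selfisomKV g x : g ((g^-1)%g x) = x.
Proof. by rewrite -selfisomME mulgV. Qed.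

Lemma stab_sub A B : {subset A <= B} -> stab B `<=` stab A.
Proof. by move=> AB g gB a /AB/gB. Qed.
Lemma stabM A g h : stab A g -> stab A h -> stab A (g * h)%g.
Proof. by move=> gA hA a aA; rewrite selfisomME hA// gA. Qed.
Lemma stabV A g : stab A g -> stab A (g^-1)%g.
Proof. by move=> gA a aA; rewrite -[in LHS](gA a aA) selfisomVK. Qed.
Lemma stabJ A g h : stab (map g A) h <-> stab A (g^-1 * h * g)%g.
Proof.
split=> hA a.
  by move=> aA; rewrite !selfisomME hA ?selfisomVK//; exact: map_f.
move=> /mapP[x xA ->]; have := hA x xA; rewrite !selfisomME => e.
by rewrite -{2}e selfisomKV.
Qed.

Definition subgroup (Gam : set (selfisom U)) :=
  (forall g h, Gam g -> Gam h -> Gam (g * h)%g) /\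
  (forall g, Gam g -> Gam (g^-1)%g).

End Stab.

(** * Free amalgamation *)

Section Tagged.
Variable T : eqType.
Implicit Types (A B : seq T) (x : T).

(** A disjoint union, to index the families in which the points of two lists, which
    may overlap, are treated differently. *)
Definition tagged_seq A B : seq (bool * T) :=
  [seq (true, a) | a <- A] ++ [seq (false, b) | b <- B].

Lemma tagged_seqT A B x : ((true, x) \in tagged_seq A B) = (x \in A).
Proof.
rewrite mem_cat (mem_map (f := pair true)); last by move=> ? ? [].
by apply/orb_idr => /mapP[].
Qed.

Lemma tagged_seqF A B x : ((false, x) \in tagged_seq A B) = (x \in B).
Proof.
rewrite mem_cat (mem_map (f := pair false)); last by move=> ? ? [].
by apply/orb_idl => /mapP[].
Qed.

End Tagged.

Section FreeDistance.
Variables (R : realType) (U : metricType R).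
Implicit Types (x y : U) (B : seq U).

Lemma seq_argmin (f : U -> R) B : B != [::] ->
  exists2 b, b \in B & forall c, c \in B -> f b <= f c.
Proof.
elim: B => // b B IH _; have [->|/IH[c cB hc]] := eqVneq B [::].
  by exists b; rewrite ?mem_head// => c; rewrite inE => /eqP->.
have [bc|cb] := leP (f b) (f c).
  exists b; rewrite ?mem_head// => d; rewrite inE => /orP[/eqP->//|/hc].
  exact: le_trans.
exists c; rewrite ?inE ?cB ?orbT// => d; rewrite inE => /orP[/eqP->|/hc//].
exact: ltW.
Qed.

Definition is_via B x y (t : R) :=
  (exists2 b, b \in B & t = mdist x b + mdist b y) /\
  forall b, b \in B -> t <= mdist x b + mdist b y.
(** The length of a shortest path from [x] to [y] through a point of [B]. *)
Definition via B x y : R := xget 0 [set t | is_via B x y t].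

Lemma viaP B x y : B != [::] -> is_via B x y (via B x y).
Proof.
move=> /(seq_argmin (fun b => mdist x b + mdist b y))[b bB hb].
by apply: (@xgetI _ 0 (is_via B x y) (mdist x b + mdist b y)); split=> //; exists b.
Qed.

Lemma via_le B B' x y x' y' : B != [::] -> B' != [::] ->
  (forall b', b' \in B' -> exists2 b, b \in B &
     mdist x b + mdist b y <= mdist x' b' + mdist b' y') ->
  via B x y <= via B' x' y'.
Proof.
move=> B0 B0' h; have [[b' b'B ->] _] := viaP x' y' B0'.
have [b bB] := h _ b'B; apply: le_trans.
by have [_] := viaP x y B0; apply.
Qed.

Lemma viaC B x y : B != [::] -> via B x y = via B y x.
Proof.
move=> B0; apply/eqP; rewrite eq_le; apply/andP; split; apply: via_le => // b bB;
  by exists b => //; rewrite addrC metric_sym (metric_sym b).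
Qed.

Lemma via_base B x b : b \in B -> via B x b = mdist x b.
Proof.
move=> bB; have B0 : B != [::] by case: B bB.
have [[c cB vc] /(_ _ bB)] := viaP x b B0.
rewrite mdistxx addr0 => h; apply/eqP; rewrite eq_le h /= vc.
exact: metric_triangle.
Qed.

Lemma via_ge0 B x y : B != [::] -> 0 <= via B x y.
Proof. by move=> /(viaP x y)[[b _ ->] _]; rewrite addr_ge0 ?mdist_ge0. Qed.

Lemma via_conj B x y (g : selfisom U) : g x = x -> g y = y -> B != [::] ->
  via (map g B) x y = via B x y.
Proof.
move=> gx gy B0; have gB0 : map g B != [::] by case: (B) B0.
have e b : mdist x (g b) + mdist (g b) y = mdist x b + mdist b y.
  by rewrite -{1}gx -{1}gy !selfisom_dist.
apply/eqP; rewrite eq_le; apply/andP; split; apply: via_le => // b.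
  by move=> bB; exists (g b); rewrite ?e//; exact: map_f.
by move=> /mapP[c cB ->]; exists c; rewrite ?e.
Qed.

Lemma via_stab B x y (g : selfisom U) : stab B g -> B != [::] ->
  via B x (g y) = via B x y.
Proof.
move=> gB B0; have e b : b \in B -> mdist b (g y) = mdist b y.
  by move=> bB; rewrite -{1}(gB b bB) selfisom_dist.
by apply/eqP; rewrite eq_le; apply/andP; split; apply: via_le => // b bB;
  exists b; rewrite ?e.
Qed.

(** Every path through [map g B] has the length of a path through [B], since [g]
    fixes the endpoints. This is the whole reason why averaging over the
    stabilizer of [B] does not see the position of [B] relative to the endpoints. *)
Lemma via_cat_conj B x y (g : selfisom U) : g x = x -> g y = y -> B != [::] ->
  via (B ++ map g B) x y = via B x y.
Proof.
move=> gx gy B0; have gB0 : B ++ map g B != [::] by case: (B) B0.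
have e b : mdist x (g b) + mdist (g b) y = mdist x b + mdist b y.
  by rewrite -{1}gx -{1}gy !selfisom_dist.
apply/eqP; rewrite eq_le; apply/andP; split; apply: via_le => // b.
  by move=> bB; exists b; rewrite // mem_cat bB.
rewrite mem_cat => /orP[bB|/mapP[c cB ->]]; first by exists b.
by exists c; rewrite ?e.
Qed.

Section Truncated.
Variables (Delta : set R) (cap : R -> R) (B : seq U).
Hypotheses (hcap : truncation Delta cap) (DU : delta_metric Delta U).
Hypothesis B0 : B != [::].

(** The distance between two points that are amalgamated freely over [B]. *)
Definition free_dist x y := cap (via B x y).

Lemma free_distC x y : free_dist x y = free_dist y x. Proof. by rewrite /free_dist viaC. Qed.

Lemma free_dist_in x y : Delta (free_dist x y).
Proof.
rewrite /free_dist; have [[b _ ->] _] := viaP x y B0.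
by case: hcap => capD _ _ _; exact: capD.
Qed.

Lemma cap_id (t y : R) : Delta y -> t <= y -> cap t = t.
Proof. by case: hcap => _ h _ _; exact: h. Qed.

Lemma cap_dist x y : cap (mdist x y) = mdist x y.
Proof. exact: cap_id (DU x y) _. Qed.

Lemma free_dist_base x b : b \in B -> free_dist x b = mdist x b.
Proof. by move=> bB; rewrite /free_dist via_base// cap_dist. Qed.

Lemma free_dist_le x x' y : free_dist x y <= mdist x x' + free_dist x' y.
Proof.
have [_ _ capm capD] := hcap.
have : via B x y <= mdist x x' + via B x' y.
  have [[b bB ->] _] := viaP x' y B0.
  have [_ /(_ _ bB)] := viaP x y B0; move=> /le_trans; apply.
  by rewrite addrA lerD2r metric_triangle.
move=> /capm/le_trans; apply.
by apply: (le_trans (capD _ _ _ _)); rewrite ?mdist_ge0 ?via_ge0// cap_dist.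
Qed.

Lemma dist_le_free_dist x x' y : mdist x x' <= free_dist x y + free_dist x' y.
Proof.
have [_ _ capm capD] := hcap.
have : mdist x x' <= via B x y + via B x' y.
  have dvia z : mdist z y <= via B z y.
    by have [[b bB ->] _] := viaP z y B0; exact: metric_triangle.
  apply: (le_trans (metric_triangle x y x')).
  by rewrite lerD// metric_sym.
move=> /capm; rewrite cap_dist => /le_trans; apply.
by apply: capD; rewrite via_ge0.
Qed.

End Truncated.
End FreeDistance.

Section FreeCopies.
Variables (R : realType) (Delta : set R) (U : metricType R).
Hypotheses (hDelta : distance_set Delta) (hU : urysohn Delta U).
Implicit Types (x y : U) (g h : selfisom U) (A B E F : seq U).

Lemma urysohn_delta_metric : delta_metric Delta U. Proof. by case: hU. Qed.

Lemma extension_family (I : eqType) (s : seq I) (p : I -> U) (f : I -> R) :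
  (forall i, i \in s -> Delta (f i)) ->
  (forall i j, i \in s -> j \in s -> f i <= mdist (p i) (p j) + f j) ->
  (forall i j, i \in s -> j \in s -> mdist (p i) (p j) <= f i + f j) ->
  exists z, forall i, i \in s -> mdist z (p i) = f i.
Proof.
move=> Df f1 f2.
have /choice[q hq] (x : U) : exists t, forall i, i \in s -> p i = x -> f i = t.
  have [[i [si <-]]|h] := pselect (exists i, i \in s /\ p i = x).
    exists (f i) => j sj pji; apply/eqP; rewrite eq_le; apply/andP; split.
      by have := f1 _ _ sj si; rewrite pji mdistxx add0r.
    by have := f1 _ _ si sj; rewrite pji mdistxx add0r.
  by exists 0 => i si pix; case: h; exists i.
have qp i : i \in s -> q (p i) = f i by move=> si; rewrite -(hq _ i).
have [x|x y|x y|z hz] := @extension _ _ _ hDelta hU (map p s) q.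
- by move=> /mapP[i si ->]; rewrite qp//; exact: Df.
- by move=> /mapP[i si ->] /mapP[j sj ->]; rewrite !qp//; exact: f1.
- by move=> /mapP[i si ->] /mapP[j sj ->]; rewrite !qp//; exact: f2.
by exists z => i si; rewrite hz ?map_f// qp.
Qed.

(** The points of the copy of [A] are added one at a time, as one-point extensions
    whose distances to [B ++ E] are the free ones. *)
Lemma free_copy (cap : R -> R) A B E : truncation Delta cap -> B != [::] ->
  exists2 h, stab B h &
    forall a e, a \in A -> e \in E -> mdist (h a) e = free_dist cap B a e.
Proof.
move=> hcap B0; have DU := urysohn_delta_metric.
suff [q [qA qE]] : exists q : U -> U,
    (forall a a', a \in A -> a' \in A -> mdist (q a) (q a') = mdist a a') /\
    (forall a e, a \in A -> e \in B ++ E -> mdist (q a) e = free_dist cap B a e).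
  have sT := tagged_seqT A B; have sF := tagged_seqF A B.
  pose q' (i : bool * U) := if i.1 then q i.2 else i.2.
  have dAB a b : a \in A -> b \in B -> mdist a b = mdist (q a) b.
    move=> aA bB; rewrite qE ?mem_cat ?bB//.
    by rewrite (free_dist_base hcap DU).
  have [[[] x] [[] y]|g hg] := homogeneity hU (s := tagged_seq A B) (p := snd) (q := q').
  - by rewrite !sT => xA yA; rewrite /q' /= qA.
  - by rewrite sT sF => xA yA; rewrite /q' /= dAB.
  - by rewrite sT sF => xA yA; rewrite /q' /= !(metric_sym x) dAB.
  - by [].
  exists g => [b bB|a e aA eE]; first by rewrite (hg (false, b)) ?sF.
  by rewrite (hg (true, a)) ?sT// /q' /= qE// mem_cat eE orbT.
elim: A => [|a A [q [qA qE]]]; first by exists id; split.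
have [aA|aA] := boolP (a \in A).
  have e : a :: A =i A by move=> x; rewrite inE; case: eqP => // ->.
  by exists q; split=> x y; rewrite !e; [exact: qA|exact: qE].
have sT := tagged_seqT A (B ++ E); have sF := tagged_seqF A (B ++ E).
pose p (i : bool * U) := if i.1 then q i.2 else i.2.
pose f (i : bool * U) := if i.1 then mdist a i.2 else free_dist cap B a i.2.
have fle := free_dist_le hcap DU B0; have dle := dist_le_free_dist hcap DU B0.
have fC := free_distC cap B0.
have [[[] x] _|[[] x] [[] y]|[[] x] [[] y]|z hz] := @extension_family _ (tagged_seq A (B ++ E)) p f.
- exact: DU.
- exact: (free_dist_in hcap DU B0).
- rewrite !sT /f /p /= => xA yA; rewrite qA// (metric_sym x) addrC.
  exact: metric_triangle.
- rewrite sT sF /f /p /= => xA yA; rewrite qE// addrC; exact: dle.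
- rewrite sT sF /f /p /= => xA yA; rewrite metric_sym qE// addrC.
  exact: fle.
- rewrite !sF /f /p /= => xA yA; rewrite fC (fC a y); exact: fle.
- rewrite !sT /f /p /= => xA yA; rewrite qA// (metric_sym a).
  exact: metric_triangle.
- rewrite sT sF /f /p /= => xA yA; rewrite qE// metric_sym; exact: fle.
- rewrite sT sF /f /p /= => xA yA; rewrite metric_sym qE// addrC metric_sym.
  exact: fle.
- rewrite !sF /f /p /= => xA yA; rewrite !(fC a); exact: dle.
exists (fun x => if x == a then z else q x); split=> x y.
  rewrite !inE; case: (eqVneq x a) => [->|_] /=; case: (eqVneq y a) => [->|_] //=.
  - by rewrite !mdistxx.
  - by move=> _ yA; have := hz (true, y); rewrite sT; apply.
  - move=> xA _; have := hz (true, x); rewrite sT metric_sym (metric_sym x).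
    by apply.
  - exact: qA.
rewrite inE; case: (eqVneq x a) => [->|_] /=; last exact: qE.
by move=> _ yE; have := hz (false, y); rewrite sF; apply.
Qed.

Lemma homogeneity_over F x x' : (forall y, y \in F -> mdist x y = mdist x' y) ->
  exists2 g, stab F g & g x = x'.
Proof.
move=> h; have sT := tagged_seqT [:: x] F; have sF := tagged_seqF [:: x] F.
have [[[] y] [[] z]|g hg] := @homogeneity _ _ _ hU _ (tagged_seq [:: x] F) snd
    (fun i => if i.1 then x' else i.2).
- by rewrite !sT !inE /= => /eqP-> /eqP->; rewrite !mdistxx.
- by rewrite sT sF inE /= => /eqP->; exact: h.
- by rewrite sT sF inE /= => yF /eqP->; rewrite !(metric_sym y) h.
- by [].
exists g => [y yF|]; first by rewrite (hg (false, y)) ?sF.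
by rewrite (hg (true, x)) ?sT ?mem_head.
Qed.

(** * Stabilizers generate the stabilizer of the intersection *)

Section Generation.
Variable Gam : set (selfisom U).
Hypothesis hGam : subgroup Gam.

(** The point [m] sits halfway between [a] and [x], and over [F] like [c]; the
    inequalities say that these prescribed distances form a one-point extension. *)
Lemma midpoint F a x c eps : Delta eps -> mdist a x <= eps + eps ->
  (forall y, y \in F -> mdist x y = mdist a y) ->
  (forall y, y \in F -> [/\ eps <= mdist a y + mdist c y,
     mdist a y <= eps + mdist c y & mdist c y <= eps + mdist a y]) ->
  exists m, [/\ mdist a m = eps, mdist m x = eps &
     forall y, y \in F -> mdist m y = mdist c y].
Proof.
move=> De ax xF hF; have DU := urysohn_delta_metric.
have e0 := distance_set_ge0 hDelta De.
have sT := tagged_seqT [:: a; x] F; have sF := tagged_seqF [:: a; x] F.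
have axF z y : z \in [:: a; x] -> y \in F -> mdist z y = mdist a y.
  by rewrite !inE => /orP[/eqP->|/eqP->] //; exact: xF.
pose f (i : bool * U) := if i.1 then eps else mdist c i.2.
have [[[] y] _|[[] y] [[] z]|[[] y] [[] z]|m hm] := @extension_family _ (tagged_seq [:: a; x] F) snd f.
- by [].
- exact: DU.
- by rewrite /f /= lerDr mdist_ge0.
- by rewrite sT sF /f /= => yA zF; rewrite (axF _ _ yA zF); case: (hF _ zF).
- rewrite sT sF /f /= => yF zA; rewrite (metric_sym y) (axF _ _ zA yF) addrC.
  by case: (hF _ yF).
- by rewrite /f /= addrC (metric_sym y) => _ _; exact: metric_triangle.
- rewrite !sT !inE /f /= => /orP[/eqP->|/eqP->] /orP[/eqP->|/eqP->];
    rewrite ?mdistxx ?addr_ge0//.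
  by rewrite metric_sym.
- by rewrite sT sF /f /= => yA zF; rewrite (axF _ _ yA zF); case: (hF _ zF).
- rewrite sT sF /f /= => yF zA; rewrite (metric_sym y) (axF _ _ zA yF) addrC.
  by case: (hF _ yF).
- by rewrite /f /= (metric_sym c) => _ _; exact: metric_triangle.
exists m; split=> [||y yF].
- by rewrite metric_sym; apply: (hm (true, a)); rewrite sT mem_head.
- by apply: (hm (true, x)); rewrite sT !inE eqxx orbT.
- by apply: (hm (false, y)); rewrite sF.
Qed.

(** It suffices that the elements of [Gam] that fix [F] act transitively on the
    points [x] that sit over [F] like [a] does. Those with
    [mdist a x <= 2 * mdist a b] are reached in one step: a common neighbour [m]
    of [a] and [x], sitting over [F] like [b], is a translate of [b] by [stab (a :: F)],
    so that the stabilizer of [m :: F], which moves [a] to [x], lies in [Gam]. The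
    range is then doubled repeatedly, passing through midpoints. *)
Lemma stab_exchange F a b : a != b ->
  stab (a :: F) `<=` Gam -> stab (b :: F) `<=` Gam -> stab F `<=` Gam.
Proof.
move=> ab aG bG; have [GM GV] := hGam; have DU := urysohn_delta_metric.
pose reach x := exists g, [/\ Gam g, stab F g & g a = x].
have stabP c g : g c = c -> stab F g -> stab (c :: F) g.
  by move=> gc gF y; rewrite inE => /orP[/eqP->|/gF].
have cons_stab c g : stab (c :: F) g -> stab F g.
  by apply: stab_sub => y yF; rewrite inE yF orbT.
have d0 : 0 < mdist a b by rewrite mdist_gt0.
have base x : (forall y, y \in F -> mdist x y = mdist a y) ->
    mdist a x <= mdist a b + mdist a b -> reach x.
  move=> xF ax; have [|m [am mx mF]] := midpoint (c := b) (DU a b) ax xF.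
    move=> y _; split; first by rewrite (metric_sym b) metric_triangle.
      exact: metric_triangle.
    by rewrite (metric_sym a b) metric_triangle.
  have [|g1 g1F g1b] := @homogeneity_over (a :: F) b m.
    move=> y; rewrite inE => /orP[/eqP->|/mF//].
    by rewrite (metric_sym m) am metric_sym.
  have [|h hF ha] := @homogeneity_over (m :: F) a x.
    move=> y; rewrite inE => /orP[/eqP->|/xF//].
    by rewrite am (metric_sym x) mx.
  have hG : Gam h.
    (* h fixes m :: F, the image of b :: F under g1, so g1^-1 h g1 fixes b :: F *)
    have -> : h = (g1 * (g1^-1 * h * g1) * g1^-1)%g.
      by apply: selfisomP => y; rewrite !selfisomME !selfisomKV.
    apply: (GM _ _ (GM _ _ (aG _ g1F) _) (GV _ (aG _ g1F))).
    apply: bG; apply/stabJ => y /mapP[z]; rewrite inE => /orP[/eqP->|zF] ->.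
      by rewrite g1b hF ?mem_head.
    have zaF : z \in a :: F by rewrite inE zF orbT.
    by rewrite g1F// hF// inE zF orbT.
  by exists h; split=> //; exact: cons_stab hF.
have main k x : (forall y, y \in F -> mdist x y = mdist a y) ->
    mdist a x <= 2 ^+ k * mdist a b -> reach x.
  elim: k x => [|k IH] x xF ax.
    by apply: base => //; rewrite expr0 mul1r in ax; lra.
  have [le|gt] := leP (mdist a x) (2 ^+ k * mdist a b); first exact: IH.
  set e := 2 ^+ k * mdist a b in IH gt.
  have De : Delta e by exact: distance_set_double (DU a x) (ltW gt).
  have axe : mdist a x <= e + e by move: ax; rewrite exprS -mulrA -/e; lra.
  (* e < mdist a x <= 2 * mdist a y for y in F, so m can sit over F like a does *)
  have [|m [am mx mF]] := midpoint (c := a) De axe xF.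
    move=> y yF; have := metric_triangle a y x; rewrite (metric_sym y) xF// => axy.
    by have := distance_set_ge0 hDelta De; split; lra.
  have [g [gG gF ga]] : reach m by apply: IH; rewrite ?am.
  have [||g' [gG' gF' ga']] := IH ((g^-1)%g x).
  - move=> y yF; rewrite -(selfisom_dist g) selfisomKV gF// xF//.
  - by rewrite -(selfisom_dist g) selfisomKV ga mx.
  exists (g * g')%g; split; [exact: GM|exact: stabM|].
  by rewrite selfisomME ga' selfisomKV.
move=> g gF.
have [k ak] : exists k, mdist a (g a) <= 2 ^+ k * mdist a b.
  have q0 : 0 <= mdist a (g a) / mdist a b by rewrite divr_ge0 ?mdist_ge0.
  exists (Num.bound (mdist a (g a) / mdist a b)); rewrite -ler_pdivrMr//.
  apply: (le_trans (ltW (archi_boundP q0))).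
  by rewrite -natrX ler_nat ltnW// ltn_expl.
have [|h [hG hF ha]] := main k (g a) _ ak.
  by move=> y yF; rewrite -{1}(gF _ yF) selfisom_dist.
have -> : g = (h * (h^-1 * g))%g.
  by apply: selfisomP => y; rewrite !selfisomME selfisomKV.
apply: GM => //; apply: aG; apply: stabP.
  by rewrite selfisomME -ha selfisomVK.
by apply: stabM => //; exact: stabV.
Qed.

Lemma stab_removes F Y a : a \notin Y ->
  stab (a :: F) `<=` Gam -> stab (Y ++ F) `<=` Gam -> stab F `<=` Gam.
Proof.
elim: Y => //= y Y IH; rewrite inE negb_or => /andP[ay aY] aG yG.
apply: IH => //; apply: (stab_exchange ay) => // g gs; apply: aG.
apply: stab_sub gs => z; rewrite !inE mem_cat => /orP[->//|->].
by rewrite !orbT.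
Qed.

(** The exchange lemma removes the points of [A] outside [B] one at a time, each
    against all the points of [B]. *)
Lemma stab_inter A B : stab A `<=` Gam -> stab B `<=` Gam ->
  stab [seq a <- A | a \in B] `<=` Gam.
Proof.
move=> AG BG; set C := [seq a <- A | a \in B].
have : stab ([seq a <- A | a \notin B] ++ C) `<=` Gam.
  apply: subset_trans AG; apply: stab_sub => a aA.
  by rewrite mem_cat !mem_filter aA !andbT; case: (_ \in _).
have : all (fun a => a \notin B) [seq a <- A | a \notin B] by exact: filter_all.
elim: [seq a <- A | a \notin B] => //= x X IH /andP[xB XB] xG.
apply: IH => //; apply: (stab_removes xB xG).
apply: subset_trans BG; apply: stab_sub => b bB.
by rewrite mem_cat bB.
Qed.

End Generation.
End FreeCopies.

(** * Vectors fixed by a stabilizer and dissociation *)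

Section Fixed.
Variables (R : realType) (U : metricType R).
Variable pi : unitary_rep [set: selfisom U].
Local Notation V := (rep_space pi).
Implicit Types (g h : selfisom U) (A B E F : seq U) (u v w : V).

Lemma ip_act g u v : ip (pi g u) (pi g v) = ip u v.
Proof. by rewrite /ip (@rep_unitary _ _ _ pi g I).1. Qed.

Lemma actM g h v : pi (g * h)%g v = pi g (pi h v).
Proof. exact: rep_mul. Qed.

Lemma act_inj g : injective (pi g).
Proof.
move=> u v guv; apply/eqP; rewrite -subr_eq0; apply/eqP/sqnorm_eq0.
by rewrite -ip_sqnorm -(ip_act g) linearB guv subrr ip0l.
Qed.

Lemma act1 v : pi 1%g v = v.
Proof. by apply: (act_inj (g := 1%g)); rewrite -actM mulg1. Qed.

Lemma actVK g v : pi (g^-1)%g (pi g v) = v.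
Proof. by rewrite -actM mulVg act1. Qed.

Lemma actKV g v : pi g (pi (g^-1)%g v) = v.
Proof. by rewrite -actM mulgV act1. Qed.

Lemma ip_actl g u v : ip (pi g u) v = ip u (pi (g^-1)%g v).
Proof. by rewrite -(ip_act g u) actKV. Qed.

Lemma sqnorm_act g v : sqnorm (pi g v) = sqnorm v.
Proof. by rewrite -!ip_sqnorm ip_act. Qed.

Lemma nrm_act g v : nrm (pi g v) = nrm v.
Proof.
have := sqnorm_act g v; rewrite !sqnormE => /eqP.
by rewrite eqrXn2 ?nrm_ge0// => /eqP.
Qed.

Definition fixed A : set V := [set v | forall g, stab A g -> pi g v = v].

Lemma fixed_closed A : closed_subspace (fixed A).
Proof.
split=> [g _|a u v hu hv g gA|]; first by rewrite linear0.
  by rewrite linearP /= hu// hv.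
apply/closedP => u hu g gA; apply/eqP; rewrite -subr_eq0; apply/eqP/sqnorm_eq0.
set y := pi g u - u; rewrite -ip_sqnorm {1}/y ipBl ip_actl -ipBr.
by apply: (adherent_ip hu) => w hw; rewrite ipBr -ip_actl hw// subrr.
Qed.

Lemma fixed_sub A B : {subset A <= B} -> fixed A `<=` fixed B.
Proof. by move=> AB v hv g /(stab_sub AB); exact: hv. Qed.

Lemma fixed_eq A B : A =i B -> fixed A = fixed B.
Proof. by move=> e; apply/seteqP; split; apply: fixed_sub => x; rewrite e. Qed.

Lemma fixed_act A g v : fixed (map g A) (pi g v) <-> fixed A v.
Proof.
split=> hv h hA.
  have hgA : stab (map g A) (g * h * g^-1)%g.
    by apply/stabJ; rewrite !mulgA mulVg mul1g -mulgA mulVg mulg1.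
  by have := hv _ hgA; rewrite !actM actVK => /act_inj.
by have /stabJ/hv := hA; rewrite !actM => /(congr1 (pi g)); rewrite actKV.
Qed.

Notation P A := (proj (fixed A)).

Lemma proj_fixed A v : fixed A (P A v).
Proof. exact: proj_in (fixed_closed A) v. Qed.

Lemma proj_act A g v : pi g (P A v) = P (map g A) (pi g v).
Proof.
apply/esym/(proj_eq (fixed_closed _)) => [|x hx].
  exact/fixed_act/proj_fixed.
rewrite !ip_actl (proj_ipl (fixed_closed A))//.
by apply/(fixed_act A g); rewrite actKV.
Qed.

Lemma proj_proj A B v : {subset A <= B} -> P A (P B v) = P A v.
Proof.
by move=> AB; apply: proj_comp; [exact: fixed_closed..|exact: fixed_sub].
Qed.

(** The dyadic convex hull of the orbit of [v]. Midpoints suffice for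
    [min_norm_point], and make the inductions below binary. *)
Inductive orbit_hull B v : V -> Prop :=
| orbit_hull_base g : stab B g -> orbit_hull B v (pi g v)
| orbit_hull_mid x y : orbit_hull B v x -> orbit_hull B v y -> orbit_hull B v (mid x y).

Lemma act_mid g u v : pi g (mid u v) = mid (pi g u) (pi g v).
Proof. by rewrite /mid linearZ linearD. Qed.

Lemma orbit_hull_act B v g w : stab B g -> orbit_hull B v w -> orbit_hull B v (pi g w).
Proof.
move=> gB; elim=> [h hB|x y _ hx _ hy]; last by rewrite act_mid; exact: orbit_hull_mid.
by rewrite -actM; apply: orbit_hull_base; exact: stabM.
Qed.

Lemma orbit_hull_ip B v w x : fixed B x -> orbit_hull B v w -> ip w x = ip v x.
Proof.
move=> hx; elim=> [g gB|y z _ hy _ hz].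
  by rewrite ip_actl hx//; exact: stabV.
by rewrite mid_ip hy hz; lra.
Qed.

(** The point of minimal norm of the closed convex hull of the orbit is unique,
    hence fixed by the group; it has the same inner products as [v] with the fixed
    vectors, so it is the projection of [v]. *)
Lemma proj_adherent B v : adherent (orbit_hull B v) (P B v).
Proof.
have [||u [hu umin uuniq]] := @min_norm_point _ _ (orbit_hull B v).
- by exists (pi 1%g v); exact: orbit_hull_base.
- exact: orbit_hull_mid.
suff -> : P B v = u by [].
apply: (proj_eq (fixed_closed B)) => [g gB|x hx].
  apply: uuniq; last by rewrite nrm_act.
  move=> e /hu[w hw we]; exists (pi g w); first exact: orbit_hull_act.
  by rewrite -linearB nrm_act.
by apply: (adherent_ip hu) => w; exact: orbit_hull_ip.
Qed.

(** Since [v] is fixed by [stab A], the vector [pi g v] only depends on the copy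
    [map g A]; by homogeneity the inner product then only depends on the isometry
    type of a pair of copies. *)
Lemma ip_type (Delta : set R) (hU : urysohn Delta U) A B v w g1 h1 g2 h2 :
  fixed A v -> fixed B w ->
  (forall a b, a \in A -> b \in B -> mdist (g1 a) (h1 b) = mdist (g2 a) (h2 b)) ->
  ip (pi g1 v) (pi h1 w) = ip (pi g2 v) (pi h2 w).
Proof.
move=> hv hw hd.
have sT := tagged_seqT A B; have sF := tagged_seqF A B.
pose p g h (i : bool * U) : U := if i.1 then g i.2 else h i.2.
have [[[] x] [[] y]|k hk] := @homogeneity _ _ _ hU _ (tagged_seq A B) (p g1 h1) (p g2 h2).
- by rewrite /p /= !selfisom_dist.
- by rewrite sT sF; exact: hd.
- by rewrite sT sF /p /= => xB yA; rewrite metric_sym hd// metric_sym.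
- by rewrite /p /= !selfisom_dist.
have move1 F x g h : fixed F x -> (forall a, a \in F -> k (g a) = h a) ->
    pi k (pi g x) = pi h x.
  move=> hx e; apply: (act_inj (g := (h^-1)%g)); rewrite actVK -!actM.
  by apply: hx => a aF; rewrite !selfisomME e// selfisomVK.
rewrite -(ip_act k) (move1 A v g1 g2)// ?(move1 B w h1 h2)// => a aX.
  by apply: (hk (false, a)); rewrite sF.
by apply: (hk (true, a)); rewrite sT.
Qed.

Section Dissociation.
Variable Delta : set R.
Hypotheses (hDelta : distance_set Delta) (hU : urysohn Delta U).

(** Approximate [P B v] by a combination [w] of translates of [v] by [stab B]. A
    copy [pi h v] free over [B] from all these translates has the same inner product
    [t] with each of them, hence with [w], because the coefficients sum to 1. On
    the other hand [ip (P B v) (pi h v)] is the squared norm of [P B v]. *)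
Lemma sqnorm_proj_free (cap : R -> R) A B v h1 h2 : truncation Delta cap ->
  B != [::] -> fixed A v ->
  (forall a a', a \in A -> a' \in A -> mdist (h1 a) (h2 a') = free_dist cap B a a') ->
  ip (pi h1 v) (pi h2 v) = sqnorm (P B v).
Proof.
move=> hcap B0 hv hd; set t := ip _ _.
have DU := urysohn_delta_metric hU.
have hullE w : orbit_hull B v w -> exists E, forall h, stab B h ->
    (forall a e, a \in A -> e \in E -> mdist (h a) e = free_dist cap B a e) ->
    ip w (pi h v) = t.
  elim=> [g gB|x y _ [E hE] _ [F hF]].
    (* the translate of v by g is carried by the copy map g A *)
    exists (map g A) => h hB hhd; rewrite /t ipC.
    apply: (ip_type hU hv hv) => a b aA bA; rewrite hhd ?map_f// hd//.
    by rewrite /free_dist via_stab.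
  exists (E ++ F) => h hB hhd.
  rewrite mid_ip hE// ?hF//; first by lra.
  + by move=> a e aA eF; apply: hhd => //; rewrite mem_cat eF orbT.
  + by move=> a e aA eF; apply: hhd => //; rewrite mem_cat eF.
apply/eqP; rewrite -subr_eq0 -normr_le0.
suff H (e : R) : 0 < e -> `|t - sqnorm (P B v)| <= e.
  by apply/ler_addgt0Pr => e e0; rewrite add0r H.
move=> e0; have y1 : 0 < nrm v + 1 by rewrite ltr_wpDl ?nrm_ge0.
have [w hw we] := @proj_adherent B v _ (divr_gt0 e0 y1).
have [E hE] := hullE w hw.
have [h hB hhd] := free_copy hDelta hU A E hcap B0.
have -> : sqnorm (P B v) = ip (P B v) (pi h v).
  rewrite ipC ip_actl (@proj_fixed B v)//; last exact: stabV.
  by rewrite -ip_sqnorm (proj_ipl (fixed_closed B))//; exact: proj_fixed.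
rewrite -(hE h hB hhd) -ipBl; apply: (le_trans (ler_norm_ip _ _)).
rewrite nrm_act; move: we; rewrite ltr_pdivlMr// mulrDr mulr1 => we.
by have := nrm_ge0 (w - P B v); lra.
Qed.

(** For [g] in [stab A], the sets [B], [map g B] and their union define the same
    free distances on [A], so the projections of [v] on the three spaces of fixed
    vectors have the same norm. The third space contains the other two, so the
    three projections coincide, whence [pi g (P B v) = P (map g B) v = P B v]. *)
Lemma proj_fixed_both A B v : B != [::] -> fixed A v -> fixed A (P B v).
Proof.
move=> B0 hv; have [cap hcap] := truncation_exists hDelta => g gA.
have gB0 : map g B != [::] by case: (B) B0.
have BgB0 : B ++ map g B != [::] by case: (B) B0.
have [h hB hhd] := free_copy hDelta hU A A hcap B0.
have e1 := sqnorm_proj_free hcap B0 hv (h1 := h) (h2 := 1%g) hhd.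
have e2 : ip (pi h v) (pi 1%g v) = sqnorm (P (map g B) v).
  apply: (sqnorm_proj_free hcap _ hv) => // a a' aA aA'.
  by rewrite selfisom1E hhd// /free_dist via_conj ?gA//.
have e3 : ip (pi h v) (pi 1%g v) = sqnorm (P (B ++ map g B) v).
  apply: (sqnorm_proj_free hcap _ hv) => // a a' aA aA'.
  by rewrite selfisom1E hhd// /free_dist via_cat_conj ?gA//.
have eqP_cat C : {subset C <= B ++ map g B} ->
    sqnorm (P C v) = sqnorm (P (B ++ map g B) v) -> P C v = P (B ++ map g B) v.
  move=> CB e; rewrite -(proj_proj v CB); apply: (sqnorm_proj_id (fixed_closed C)).
  by rewrite proj_proj.
have eB : P B v = P (B ++ map g B) v.
  by apply: eqP_cat => [x xB|]; [rewrite mem_cat xB|rewrite -e1 -e3].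
have egB : P (map g B) v = P (B ++ map g B) v.
  by apply: eqP_cat => [x xB|]; [rewrite mem_cat xB orbT|rewrite -e2 -e3].
by rewrite proj_act (hv g gA) egB eB.
Qed.

Lemma fixed_inter A B v : fixed A v -> fixed B v -> fixed [seq a <- A | a \in B] v.
Proof.
move=> hA hB g; apply: (stab_inter hDelta hU (Gam := [set g | pi g v = v])) => //.
split=> [h k /= hv kv|h /= hv]; first by rewrite actM kv.
by rewrite -{1}hv actVK.
Qed.

(** Dissociation: the averaged vector is fixed by the stabilizers of [A] and of [B],
    which generate that of [A ∩ B]. *)
Lemma proj_fixed_inter A B v : B != [::] -> fixed A v ->
  fixed [seq a <- A | a \in B] (P B v).
Proof. by move=> B0 hv; apply: fixed_inter; [exact: proj_fixed_both|exact: proj_fixed]. Qed.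

End Dissociation.
End Fixed.

(** * Orthogonality of translates *)

(** The filter generated by the stabilizers converges pointwise to the identity. *)
Lemma nbhs_stab (R : realType) (U : metricType R) (N : set (selfisom U)) :
  nbhs (1%g : selfisom U) N -> exists A, stab A `<=` N.
Proof.
pose F : set_system (selfisom U) := filter_from [set: seq U] (@stab R U).
have FF : Filter F.
  apply: filter_from_filter; first by exists [::].
  move=> A B _ _; exists (A ++ B) => // g gAB.
  by split; apply: stab_sub gAB => x xA; rewrite mem_cat xA ?orbT.
pose ev : selfisom U -> {ptws U -> discrete_topology U} := @selfisom_ptws R U.
have F1 : {ptws, ev @ F --> ev 1%g}.
  apply/pointwise_cvgP => t; apply/discrete_cvg; exists [:: t] => // g.
  by move=> /(_ t (mem_head _ _)).
rewrite nbhsE => -[_ [[B oB <-] B1] BN].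
have [A _ AB] : F (ev @^-1` B).
  by apply: F1; apply: open_nbhs_nbhs.
by exists A; apply: subset_trans BN.
Qed.

Section Invariant.
Variables (R : realType) (U : metricType R).
Variable pi : unitary_rep [set: selfisom U].
Local Notation V := (rep_space pi).
Implicit Types (g h : selfisom U) (A B F : seq U) (u v w : V) (W L M X : set V).
Notation P A := (@proj R V (@fixed R U pi A)).

Lemma act_near_id v (e : R) : 0 < e ->
  exists A, forall g, stab A g -> nrm (pi g v - v) < e.
Proof.
move=> e0; apply: (nbhs_stab (N := [set g | nrm (pi g v - v) < e])).
have /(_ 1%g) : continuous (fun g => pi g v).
  by apply/continuous_subspace_setT; exact: (@rep_continuous _ _ _ pi v).
move=> /cvgrPdist_lt/(_ e%:C); rewrite ltcR => /(_ e0).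
by apply: filterS => g /=; rewrite act1 normE ltcR nrmB.
Qed.

(** By continuity some [stab A] moves [v] by at most half its norm, and then so
    does the averaging over [stab A], which therefore cannot send [v] to 0. *)
Lemma exists_fixed v : v != 0 -> exists A, P A v != 0.
Proof.
move=> v0; have nv : 0 < nrm v.
  by rewrite lt_neqAle nrm_ge0 andbT eq_sym; apply: contra_neq v0; exact: nrm_eq0.
have c0 : 0 < nrm v / 2 by lra.
have [A hA] := act_near_id v c0; exists A; apply/eqP => PA0.
have hullv w : orbit_hull A v w -> nrm (w - v) <= nrm v / 2.
  elim=> [g /hA/ltW//|x y _ hx _ hy].
  by rewrite midB; apply: (le_trans (nrm_mid _ _)); lra.
have [w /hullv hw] := @proj_adherent _ _ pi A v _ c0.
rewrite PA0 subr0 => wc; have := nrmD (v - w) w; rewrite subrK nrmB; lra.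
Qed.

Lemma proj_inv W g v : invariant_subspace W -> pi g (proj W v) = proj W (pi g v).
Proof.
move=> [hW gW]; apply/esym/(proj_eq hW) => [|x Wx]; first exact/gW/(proj_in hW).
by rewrite !ip_actl (proj_ipl hW)//; exact: gW.
Qed.

(** The projection on [W] commutes with the group, hence with [P A]. *)
Lemma proj_fixed_inv W A w : invariant_subspace W -> W w -> W (P A w).
Proof.
move=> iW Ww; have [hW gW] := iW; have hA := fixed_closed pi A.
suff -> : P A w = proj W (P A w) by exact: proj_in.
have fixedW x : fixed A x -> fixed A (proj W x).
  by move=> hx g gA; rewrite proj_inv// hx.
apply: (proj_eq hA) => [|x hx]; first exact/fixedW/proj_fixed.
rewrite (proj_ip hW) (proj_ipl hA); last exact: fixedW.
by rewrite -(proj_ip hW) proj_id.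
Qed.

Definition sstab A : set (selfisom U) := [set g | forall a, a \in A -> g a \in A].

Lemma sstab_map A g : sstab A g -> map g A =i A.
Proof.
move=> gA; have [|||_ e x] := @uniq_min_size _ (map g (undup A)) (undup A).
- by rewrite map_inj_uniq ?undup_uniq//; exact: selfisom_inj.
- by move=> _ /mapP[a aA ->]; rewrite mem_undup gA// -mem_undup.
- by rewrite size_map.
rewrite -[RHS]mem_undup -e.
by apply/mapP/mapP => -[y yA ->]; exists y; rewrite // ?mem_undup// -mem_undup.
Qed.

Lemma setwise_stabilizerE A : setwise_stabilizer [set x | x \in A] = sstab A.
Proof.
apply/seteqP; split=> [g gA a aA|g gA].
  have : (g @` [set x | x \in A]) (g a) by exists a.
  by rewrite [X in X _]gA.
apply/seteqP; split=> [_ [a aA <-]|a /=]; first exact: gA.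
by rewrite -(sstab_map gA) => /mapP[b bA ->]; exists b.
Qed.

Lemma sstabV A g : sstab A g -> sstab A (g^-1)%g.
Proof.
move=> gA a; rewrite -(sstab_map gA) => /mapP[b bA ->].
by rewrite selfisomVK.
Qed.

Lemma stab_sstab A : stab A `<=` sstab A.
Proof. by move=> g gA a aA; rewrite gA. Qed.

Lemma fixed_sstab A g v : sstab A g -> fixed A v -> fixed A (pi g v).
Proof. by move=> gA hv; rewrite -(fixed_eq pi (sstab_map gA)); exact/fixed_act. Qed.

Lemma proj_sstab A g v : sstab A g -> pi g (P A v) = P A (pi g v).
Proof. by move=> gA; rewrite proj_act (fixed_eq pi (sstab_map gA)). Qed.

Definition orbit_span L : set V := cspan [set pi g x | g in [set: selfisom U] & x in L].

Lemma orbit_span_inv L : invariant_subspace (orbit_span L).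
Proof.
split=> [|g _ v hv y a hy]; first exact: cspan_closed.
rewrite ip_actl linearZ; apply: hv => x b [h _ [z Lz <-]].
by rewrite ip_actl invgK linearZ -actM; apply: hy; exists (g * h)%g => //; exists z.
Qed.

Lemma sub_orbit_span L : L `<=` orbit_span L.
Proof. by move=> x Lx; apply: sub_cspan; exists 1%g => //; exists x; rewrite ?act1. Qed.

Lemma orbit_span_min L W : invariant_subspace W -> L `<=` W -> orbit_span L `<=` W.
Proof.
move=> [hW gW] LW; apply: cspan_min => // _ [g _ [x Lx <-]].
exact/gW/LW.
Qed.

(** Every translate of the space of vectors of [W] fixed by [stab A] is either
    that space or orthogonal to it. *)
Definition dissociated W A := forall g v w, W v -> fixed A v -> W w -> fixed A w ->
  ~ sstab A g -> ip (pi g v) w = 0.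

Section Minimal.
Variable Delta : set R.
Hypotheses (hDelta : distance_set Delta) (hU : urysohn Delta U).

(** Take [A] of minimal size with a nonzero vector of [W] fixed by [stab A]. If [g]
    does not preserve [A], then projecting a vector fixed by [stab (map g A)] on the
    vectors fixed by [stab A] gives, by dissociation, a vector of [W] fixed by the
    stabilizer of a smaller set, that is 0. *)
Lemma exists_dissociated W : invariant_subspace W -> (exists2 v, W v & v != 0) ->
  exists A, (exists v, [/\ W v, fixed A v & v != 0]) /\ dissociated W A.
Proof.
move=> iW [v0 Wv0 v00].
pose Q n := `[< exists A, size A = n /\ exists v, [/\ W v, fixed A v & v != 0] >].
have exQ : exists n, Q n.
  have [A PA] := exists_fixed v00; exists (size A); apply/asboolP.
  exists A; split=> //; exists (P A v0); split=> //.
    exact: proj_fixed_inv.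
  exact: proj_fixed.
have := ex_minnP exQ => -[n /asboolP[A [An hA]] nmin].
exists A; split=> // g v w Wv hv Ww hw ngA.
have gv : fixed (map g A) (pi g v) by apply/fixed_act.
have A0 : A != [::] by apply: contra_notN ngA => /eqP->.
have := proj_fixed_inter hDelta hU A0 gv.
set B := [seq _ <- _ | _]; move=> hB.
have [PA0|/eqP PA0] := eqVneq (P A (pi g v)) 0.
  by rewrite -(proj_id (fixed_closed pi A) hw) -(proj_ip (fixed_closed pi A)) PA0 ip0l.
have : Q (size B).
  apply/asboolP; exists B; split=> //; exists (P A (pi g v)); split=> //.
    by apply: proj_fixed_inv => //; apply: iW.2.
  exact/eqP.
move=> /nmin; rewrite leqNgt -An -(size_map g) => /negP[].
rewrite size_filter ltn_neqAle count_size andbT -all_count.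
by apply: contra_notN ngA => /allP gA a aA; apply: gA; exact: map_f.
Qed.

End Minimal.

(** For [v] in the left-hand side, [v - proj L v] is orthogonal to every translate of
    [L]: to those by [sstab A] as they lie in [L], and to the others as [A] is
    dissociated. But it also lies in the span of these translates. *)
Lemma orbit_span_fixed W A L : invariant_subspace W -> dissociated W A ->
  closed_subspace L -> L `<=` W `&` fixed A ->
  (forall g, sstab A g -> forall v, L v -> L (pi g v)) ->
  orbit_span L `&` fixed A `<=` L.
Proof.
move=> iW dA hL LW Linv v [Mv hv].
have Wv : W v by apply: (orbit_span_min iW) Mv => x /LW[].
pose z := v - proj L v.
have zL x : L x -> ip z x = 0 by exact: (projP hL v).2.
have [Wp hp] := LW _ (proj_in hL v).
have Wz : W z by apply: (subspaceB iW.1).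
have hz : fixed A z by apply: (subspaceB (fixed_closed pi A)).
have zX : perp [set pi g x | g in [set: selfisom U] & x in L] z.
  move=> _ a [g _ [x Lx <-]]; rewrite -linearZ.
  have Lax : L (a *: x) by exact: subspaceZ.
  have [gA|gA] := pselect (sstab A g); first exact/zL/Linv.
  by have [Wx hx] := LW _ Lax; rewrite ipC; exact: dA gA.
have : ip z z = 0 by rewrite {1}/z ipBl (perp_ip Mv zX) ipC zL ?subrr//; exact: proj_in.
rewrite ip_sqnorm => /sqnorm_eq0/eqP; rewrite subr_eq0 => /eqP->.
exact: proj_in.
Qed.

End Invariant.

(** * Hilbert sums of orthogonal subspaces *)

Section EsumSeq.
Variables (R : realType) (T : choiceType) (J : set T) (a : T -> R).

Lemma esum_ge_seq (s : seq T) : uniq s -> (forall j, j \in s -> J j) ->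
  ((\sum_(j <- s) a j)%:E <= \esum_(j in J) (a j)%:E)%E.
Proof.
move=> us sJ; apply: esum_ge; exists [set` s] => //.
by rewrite -fsbig_seq// sumEFin.
Qed.

Lemma esum_le_seq (c : R) :
  (forall s : seq T, uniq s -> (forall j, j \in s -> J j) -> \sum_(j <- s) a j <= c) ->
  (\esum_(j in J) (a j)%:E <= c%:E)%E.
Proof.
move=> h; apply: ge_ereal_sup => _ [X [/finite_seqP[s ->] sJ] <-].
have -> : [set` s] = [set` undup s] by apply/seteqP; split=> x /=; rewrite mem_undup.
rewrite -fsbig_seq ?undup_uniq// sumEFin lee_fin h ?undup_uniq// => j.
by rewrite mem_undup; exact: sJ.
Qed.

Lemma esum_lt_seq (E e : R) : (\esum_(j in J) (a j)%:E)%E = E%:E -> 0 < e ->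
  exists s : seq T, [/\ uniq s, forall j, j \in s -> J j & E - e < \sum_(j <- s) a j].
Proof.
move=> hE e0; apply: contrapT => hs.
suff : (\esum_(j in J) (a j)%:E <= (E - e)%:E)%E by rewrite hE lee_fin; lra.
apply: esum_le_seq => s us sJ; rewrite leNgt; apply/negP => lt.
by apply: hs; exists s.
Qed.

End EsumSeq.

Section HilbertSum.
Variables (R : realType) (V : hilbertType R) (T : choiceType) (J : set T).
Variable W : T -> set V.
Hypothesis hW : forall j, J j -> closed_subspace (W j).
Hypothesis orthW : forall i j x y, J i -> J j -> i != j -> W i x -> W j y -> ip x y = 0.

Section Sums.
Variable w : T -> V.
Hypothesis hw : forall j, J j -> W j (w j).
Let S (s : seq T) : V := \sum_(j <- undup s) w j.
Let q (s : seq T) : R := \sum_(j <- undup s) sqnorm (w j).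
Let inJ (s : seq T) := forall j, j \in s -> J j.

Lemma ip_sumr (x : V) (s : seq T) (f : T -> V) :
  ip x (\sum_(j <- s) f j) = \sum_(j <- s) ip x (f j).
Proof. by elim/big_ind2: _ => [|? ? ? ? <- <-|//]; rewrite ?ip0r ?ipDr. Qed.

Lemma ip_partial s j x : inJ s -> j \in s -> W j x -> ip (S s) x = ip (w j) x.
Proof.
move=> sJ js Wx; have Jj := sJ _ js.
rewrite ipC ip_sumr (bigD1_seq j) ?undup_uniq ?mem_undup//= ipC.
rewrite big_seq_cond big1 ?addr0// => i /andP[]; rewrite mem_undup => si ij.
have Ji := sJ _ si.
by apply: (@orthW j i) => //; [rewrite eq_sym|exact: hw].
Qed.

Lemma ip_partial_sub s t : inJ t -> {subset s <= t} -> ip (S t) (S s) = q s.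
Proof.
move=> tJ st; rewrite ip_sumr; apply: eq_big_seq => j; rewrite mem_undup => js.
have Jj := tJ _ (st _ js).
by rewrite (ip_partial tJ (st _ js) (hw Jj)) ip_sqnorm.
Qed.

Lemma sqnorm_partial s : inJ s -> sqnorm (S s) = q s.
Proof. by move=> sJ; rewrite -ip_sqnorm ip_partial_sub. Qed.

Lemma sqnorm_partialB s t : inJ t -> {subset s <= t} ->
  sqnorm (S t - S s) = q t - q s.
Proof.
move=> tJ st; have sJ : inJ s by move=> j /st; exact: tJ.
rewrite sqnormB (ip_partial_sub tJ st) !sqnorm_partial//; lra.
Qed.

(** Finite partial sums that are nearly maximal in norm form a Cauchy sequence, and
    enlarging them hardly changes them. The index [s0] expresses convergence along
    the net of finite sets. *)
Lemma partial_sums_cvg : (\esum_(j in J) (sqnorm (w j))%:E < +oo)%E ->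
  exists v, forall s0, inJ s0 ->
    adherent [set S t | t in [set t | inJ t /\ {subset s0 <= t}]] v.
Proof.
move=> fin.
have [E hE] : exists E : R, (\esum_(j in J) (sqnorm (w j))%:E)%E = E%:E.
  exists (fine (\esum_(j in J) (sqnorm (w j))%:E)); rewrite fineK// ge0_fin_numE//.
  by apply: esum_ge0 => j _; rewrite lee_fin sqnorm_ge0.
have q_le s : inJ s -> q s <= E.
  move=> sJ; rewrite -lee_fin -hE; apply: esum_ge_seq; first exact: undup_uniq.
  by move=> j; rewrite mem_undup; exact: sJ.
have /choice[s hs] (n : nat) : exists s, inJ s /\ E - n.+1%:R^-1 < q s.
  have n0 : 0 < n.+1%:R^-1 :> R by rewrite invr_gt0.
  have [s [us sJ lts]] := esum_lt_seq hE n0.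
  by exists s; split=> //; rewrite /q undup_id.
have near n t : inJ t -> {subset s n <= t} -> sqnorm (S t - S (s n)) < n.+1%:R^-1.
  move=> tJ st; rewrite sqnorm_partialB//; have := q_le t tJ; have := (hs n).2.
  by move: (n.+1%:R^-1) => d; lra.
have inJ_cat s1 s2 : inJ s1 -> inJ s2 -> inJ (s1 ++ s2).
  by move=> h1 h2 j; rewrite mem_cat => /orP[/h1|/h2].
have [e e0|v hv] := cauchy_seq_cvg (w := S \o s).
  have e2 : 0 < e / 2 by rewrite divr_gt0.
  have [N Ne] := inv_lt_sqr e2; exists N => n k Nn Nk.
  pose t := s n ++ s k; have tJ : inJ t by apply: inJ_cat; exact: (hs _).1.
  have hn : nrm (S t - S (s n)) < e / 2.
    by apply: nrm_lt => //; apply: lt_trans (Ne _ Nn); apply: near => // x xs; rewrite mem_cat xs.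
  have hk : nrm (S t - S (s k)) < e / 2.
    by apply: nrm_lt => //; apply: lt_trans (Ne _ Nk); apply: near => // x xs; rewrite mem_cat xs orbT.
  have := nrmD (S (s n) - S t) (S t - S (s k)); rewrite addrA subrK /=.
  by rewrite (nrmB (S (s n))); lra.
exists v => s0 s0J e e0; have e2 : 0 < e / 2 by rewrite divr_gt0.
have [N Ne] := inv_lt_sqr e2; have [M Mv] := hv _ e2.
(* N makes s n nearly maximal, M makes its sum close to the limit v *)
pose n := maxn N M; pose t := s n ++ s0.
have tJ : inJ t by apply: inJ_cat => //; exact: (hs _).1.
exists (S t).
  by exists t => //; split => // x xs; rewrite mem_cat xs orbT.
have hn : nrm (S t - S (s n)) < e / 2.
  apply: nrm_lt => //; apply: lt_trans (Ne _ (leq_maxl N M)).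
  by apply: near => // x xs; rewrite mem_cat xs.
have := nrmD (S t - S (s n)) (S (s n) - v); rewrite addrA subrK.
by have := Mv _ (leq_maxr N M); rewrite /=; lra.
Qed.

Lemma hilbert_sum_surj : (\esum_(j in J) (sqnorm (w j))%:E < +oo)%E ->
  exists v, (forall j, J j -> proj (W j) v = w j) /\
    ((sqnorm v)%:E <= \esum_(j in J) (sqnorm (w j))%:E)%E.
Proof.
move=> fin; have [v hv] := partial_sums_cvg fin; exists v; split=> [j Jj|].
  apply: (proj_eq (hW Jj)) => [|x Wx]; first exact: hw.
  have jJ : inJ [:: j] by move=> i; rewrite inE => /eqP->.
  apply/esym/(adherent_ip (hv _ jJ)) => _ [t [tJ jt] <-].
  by apply: ip_partial => //; apply: jt; rewrite mem_head.
have [E hE] : exists E : R, (\esum_(j in J) (sqnorm (w j))%:E)%E = E%:E.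
  exists (fine (\esum_(j in J) (sqnorm (w j))%:E)); rewrite fineK// ge0_fin_numE//.
  by apply: esum_ge0 => j _; rewrite lee_fin sqnorm_ge0.
have E0 : 0 <= E.
  by rewrite -lee_fin -hE; apply: esum_ge0 => j _; rewrite lee_fin sqnorm_ge0.
have h0 : inJ [::] by [].
rewrite hE lee_fin sqnormE -(sqr_sqrtr E0) ler_pXn2r ?nnegrE ?nrm_ge0 ?sqrtr_ge0//.
apply: (adherent_nrm_le (hv _ h0)) => _ [t [tJ _] <-].
rewrite -(ger0_norm (nrm_ge0 _)) -sqrtr_sqr ler_wsqrtr// -sqnormE sqnorm_partial//.
rewrite -lee_fin -hE; apply: esum_ge_seq; first exact: undup_uniq.
by move=> j; rewrite mem_undup; exact: tJ.
Qed.

End Sums.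

Hypothesis totW : forall v, (forall j x, J j -> W j x -> ip v x = 0) -> v = 0.

(** Bessel's inequality makes the projections of [v] summable; their sum has the
    same projections as [v], so it is [v] as the family is total. *)
Lemma parseval v : (\esum_(j in J) (sqnorm (proj (W j) v))%:E)%E = (sqnorm v)%:E.
Proof.
pose w j := proj (W j) v.
have hw j : J j -> W j (w j) by move=> Jj; exact: proj_in (hW Jj) v.
have bessel : (\esum_(j in J) (sqnorm (w j))%:E <= (sqnorm v)%:E)%E.
  apply: esum_le_seq => s us sJ.
  pose x := \sum_(j <- undup s) w j.
  have vx : ip v x = \sum_(j <- s) sqnorm (w j).
    rewrite ip_sumr undup_id//; apply: eq_big_seq => j /sJ Jj.
    by rewrite -ip_sqnorm (proj_ipl (hW Jj))//; exact: hw.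
  have := sqnorm_ge0 (v - x); rewrite sqnormB vx (sqnorm_partial hw sJ) undup_id//.
  lra.
have fin : (\esum_(j in J) (sqnorm (w j))%:E < +oo)%E.
  by apply: le_lt_trans bessel _; rewrite ltry.
have [v' [v'w le]] := hilbert_sum_surj hw fin.
have e : v = v'.
  apply/eqP; rewrite -subr_eq0; apply/eqP/totW => j x Jj Wx.
  by rewrite ipBl -(proj_ipl (hW Jj) v Wx) -(proj_ipl (hW Jj) v' Wx) v'w// subrr.
by apply/eqP; rewrite eq_le bessel /= {1}e.
Qed.

End HilbertSum.

(** * Subrepresentations *)

Section Subrep.
Variables (R : realType) (U : metricType R).
Variable pi : unitary_rep [set: selfisom U].
Local Notation V := (rep_space pi).
Variables (D : set (selfisom U)) (W : set V).
Hypothesis hW : closed_subspace W.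
Local Notation S := (subhilbert hW).
Implicit Types (g h : selfisom U) (v : S).

Lemma val_in v : W (val v). Proof. exact/set_mem/subvalP. Qed.

Lemma sub_nrm v : nrm (val v) = nrm v. Proof. by []. Qed.

Lemma valL (a : R[i]) (u v : S) : val (a *: u + v) = a *: val u + val v.
Proof. by rewrite linearP. Qed.

Definition to_sub (x : V) : S := SubHilbert hW (mem_set (proj_in hW x)).

Lemma val_to_sub x : val (to_sub x) = proj W x. Proof. by []. Qed.

(** Projecting back on [W] makes this linear for every [g], inside [D] or not. *)
Definition sub_map g v : S := to_sub (pi g (val v)).

Fact sub_map_linear g : linear (sub_map g).
Proof.
move=> a u v; apply: val_inj; rewrite valL !val_to_sub valL.
by rewrite (linearP (pi g)) (proj_linear hW).
Qed.
HB.instance Definition _ g := GRing.isLinear.Build R[i] S S _ (sub_map g) (sub_map_linear g).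

Hypothesis DV : forall g, D g -> D (g^-1)%g.
Hypothesis DW : forall g, D g -> forall x, W x -> W (pi g x).

Lemma val_sub_map g v : D g -> val (sub_map g v) = pi g (val v).
Proof. by move=> Dg; rewrite val_to_sub (proj_id hW)//; exact: DW (val_in v). Qed.

Fact sub_map_unitary g : D g -> unitary (sub_map g).
Proof.
move=> Dg; split=> [u v|v].
  rewrite /hdot /= /subdot !val_sub_map//.
  exact: (@rep_unitary _ _ _ pi g I).1.
exists (sub_map (g^-1)%g v); apply: val_inj; rewrite !val_sub_map//; last exact: DV.
exact: actKV.
Qed.

Fact sub_map_mul g h : D g -> D h ->
  forall v, sub_map (g * h)%g v = sub_map g (sub_map h v).
Proof.
move=> Dg Dh v; apply: val_inj; rewrite (val_sub_map _ Dg) (val_sub_map _ Dh).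
by rewrite val_to_sub actM (proj_id hW)//; exact/(DW Dg)/(DW Dh)/val_in.
Qed.

Fact sub_map_continuous v : {within D, continuous (fun g => sub_map g v)}.
Proof.
suff ct : continuous (fun g => sub_map g v) by exact: continuous_subspaceT.
move=> g; apply/(@cvgrPdist_lt _ _ _ (nbhs g)) => e e0.
have /(_ g) : continuous (fun g => pi g (val v)).
  by apply/continuous_subspace_setT; exact: (@rep_continuous _ _ _ pi (val v)).
move=> /cvgrPdist_lt/(_ e e0); apply: filterS => h; apply: le_lt_trans.
rewrite !normE lecR -sub_nrm raddfB.
change (nrm (proj W (pi g (val v)) - proj W (pi h (val v))) <=
        nrm (pi g (val v) - pi h (val v))).
rewrite -(ler_pXn2r (ltn0Sn 1)) ?nnegrE ?nrm_ge0//.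
have -> : proj W (pi g (val v)) - proj W (pi h (val v)) =
          proj W (pi g (val v) - pi h (val v)).
  by rewrite addrC -scaleN1r -(proj_linear hW) scaleN1r addrC.
exact: (sqnorm_proj_le hW).
Qed.

Definition subrep : unitary_rep D :=
  UnitaryRep sub_map_unitary sub_map_mul sub_map_continuous.

(** Irreducibility of a subrepresentation can be tested on subspaces of the ambient
    space. *)
Lemma subrep_irreducible : (exists2 x, W x & x != 0) ->
  (forall L, closed_subspace L -> L `<=` W ->
     (forall g, D g -> forall x, L x -> L (pi g x)) -> L `<=` [set 0] \/ W `<=` L) ->
  irreducible subrep.
Proof.
move=> [x Wx x0] irr; split.
  exists (SubHilbert hW (mem_set Wx) : S).
  by apply: contra_neq x0 => /(congr1 val).
move=> W' [hW' DW'].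
have valW' v : [set val v | v in W'] (val v) -> W' v.
  by move=> [u W'u /val_inj <-].
have [|_ [v W'v <-]|g Dg _ [v W'v <-]|h|h] := irr [set val v | v in W'].
- split.
  + by exists 0; [exact: (subspace0 hW')|rewrite raddf0].
  + move=> a _ _ [u W'u <-] [v W'v <-]; exists (a *: u + v); first exact: (subspaceL hW').
    by rewrite linearP.
  + apply/closedP => x' hx'.
    have Wx' : W x'.
      have /closedP : closed W by case: hW.
      by apply => e /hx'[_ [v _ <-] ve]; exists (val v) => //; exact: val_in.
    exists (SubHilbert hW (mem_set Wx') : S) => //.
    have /closedP : closed W' by case: hW'.
    by apply => e /hx'[_ [v W'v <-] ve]; exists v.
- exact: val_in.
- exists (sub_map g v); first exact: (DW' g Dg).
  exact: val_sub_map.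
- left; apply/seteqP; split=> [v W'v|_ ->]; last exact: (subspace0 hW').
  apply: val_inj; rewrite raddf0; apply: h; by exists v.
- by right; apply/seteqP; split=> // v _; apply/valW'/h/val_in.
Qed.

End Subrep.

(** * Irreducible representations are induced *)

Section Induced.
Variables (R : realType) (U : metricType R).
Variable pi : unitary_rep [set: selfisom U].
Local Notation V := (rep_space pi).
Implicit Types (g h : selfisom U) (q : set (selfisom U)) (v : V).
Variable A : seq U.
Local Notation D := (setwise_stabilizer [set x | x \in A]).
Local Notation P := (@proj R V (@fixed R U pi A)).
Local Notation hA := (@fixed_closed R U pi A).

Lemma setwiseV g : D g -> D (g^-1)%g.
Proof. by rewrite setwise_stabilizerE; exact: sstabV. Qed.

Lemma setwise_fixed g : D g -> forall v, fixed A v -> fixed A (pi g v).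
Proof. by rewrite setwise_stabilizerE => gA v; exact: fixed_sstab. Qed.

Definition fixed_rep : unitary_rep D := subrep hA setwiseV setwise_fixed.

Lemma fixed_rep_trivial : trivial_on fixed_rep (pointwise_stabilizer [set x | x \in A]).
Proof.
move=> g gA v; apply: val_inj.
have Dg : D g by rewrite setwise_stabilizerE; exact: stab_sstab.
by rewrite (val_sub_map setwise_fixed _ Dg); apply: (val_in v).
Qed.

(** The representative that [ind_sqnorm] evaluates functions at. *)
Definition coset_rep q : selfisom U := xget 1%g q.

Lemma coset_repP g : exists2 h, D h & coset_rep [set (g * h)%g | h in D] = (g * h)%g.
Proof.
have D1 : D 1%g by rewrite setwise_stabilizerE; exact: stab_sstab.
rewrite /coset_rep; case: xgetP => [x _ [h Dh <-]|]; first by exists h.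
by move=> /(_ g) []; exists 1%g; rewrite ?mulg1.
Qed.

Definition translate q : set V := fixed (map (coset_rep q) A).

Lemma translate_closed q : closed_subspace (translate q).
Proof. exact: fixed_closed. Qed.

Lemma translateP q x : translate q x <-> fixed A (pi ((coset_rep q)^-1)%g x).
Proof. by rewrite -(fixed_act A (coset_rep q)) actKV. Qed.

Lemma proj_translate q v :
  proj (translate q) v = pi (coset_rep q) (P (pi ((coset_rep q)^-1)%g v)).
Proof. by rewrite proj_act actKV. Qed.

(** The isomorphism with the induced representation: the value at [g] is the
    component of [v] along the translate by [g] of the inducing space. *)
Definition coeff v : selfisom U -> rep_space fixed_rep :=
  fun g => to_sub hA (pi (g^-1)%g v).

Lemma coeff_equi v g h : D h -> coeff v (g * h)%g = fixed_rep (h^-1)%g (coeff v g).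
Proof.
move=> Dh; apply: val_inj; have DVh := setwiseV Dh.
rewrite (val_sub_map setwise_fixed _ DVh) !val_to_sub proj_sstab.
  by rewrite invgM actM.
by move: DVh; rewrite setwise_stabilizerE.
Qed.

Hypothesis dA : dissociated [set: V] A.
Hypothesis totA : forall v, perp [set pi g x | g in [set: selfisom U] & x in fixed A] v ->
  v = 0.

Lemma translate_orth q q' x y : left_cosets D q -> left_cosets D q' -> q != q' ->
  translate q x -> translate q' y -> ip x y = 0.
Proof.
move=> [g _ <-] [g' _ <-] qq /translateP hx /translateP hy.
have [h Dh e] := coset_repP g; have [h' Dh' e'] := coset_repP g'.
move: hx hy; rewrite e e'; set r := (g * h)%g; set r' := (g' * h')%g => hx hy.
rewrite -(actKV r x) -(actKV r' y) ip_actl -actM ipC.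
apply: dA => // rD; move/eqP: qq; apply; rewrite -setwise_stabilizerE in rD.
have DM k k' : D k -> D k' -> D (k * k')%g.
  rewrite setwise_stabilizerE => hk hk' a aA; exact/hk/hk'.
have gg' : D (g^-1 * g')%g.
  have -> : (g^-1 * g' = h * (r^-1 * r') * h'^-1)%g.
    by rewrite /r /r' invgM -!mulgA mulVKg mulgV mulg1.
  exact: (DM _ _ (DM _ _ Dh rD) (setwiseV Dh')).
apply/seteqP; split=> _ [k Dk <-].
  exists ((g^-1 * g')^-1 * k)%g; first by apply: DM => //; exact: setwiseV.
  by rewrite invgM invgK !mulgA mulgV mul1g.
exists (g^-1 * g' * k)%g; first exact: DM.
by rewrite !mulgA mulgV mul1g.
Qed.

Lemma translate_total v :
  (forall q x, left_cosets D q -> translate q x -> ip v x = 0) -> v = 0.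
Proof.
move=> h; apply: totA => _ a [g _ [x hx <-]]; rewrite -linearZ.
have [k Dk e] := coset_repP g.
apply: (h [set (g * h)%g | h in D]); first by exists g.
apply/translateP; rewrite e -actM invgM -mulgA mulVg mulg1.
by apply: setwise_fixed; [exact: setwiseV|exact: (subspaceZ hA)].
Qed.

Lemma ind_sqnorm_coeff v : ind_sqnorm (coeff v) = (sqnorm v)%:E.
Proof.
rewrite -(@parseval _ _ _ (left_cosets D) translate (fun q _ => translate_closed q)
  translate_orth translate_total v).
apply: eq_esum => q _; rewrite proj_translate sqnorm_act.
by [].
Qed.

Lemma coeff_range : range coeff = ind_space fixed_rep.
Proof.
apply/seteqP; split=> [_ [v _ <-]|f [fE ffin]].
  by split; [move=> g h; exact: coeff_equi|rewrite ind_sqnorm_coeff ltry].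
pose w q := pi (coset_rep q) (val (f (coset_rep q))).
have wW q : left_cosets D q -> translate q (w q).
  by move=> _; apply/translateP; rewrite actVK; exact: (val_in (f (coset_rep q))).
have fin : (\esum_(q in left_cosets D) (sqnorm (w q))%:E < +oo)%E.
  rewrite (eq_esum (b := fun q => (sqnorm (f (coset_rep q)))%:E)) => [|q _]; first exact: ffin.
  by rewrite sqnorm_act.
have [v [vw _]] := hilbert_sum_surj (fun q _ => translate_closed q) translate_orth wW fin.
exists v => //; apply/funext => g.
have [h Dh e] := coset_repP g.
have : coeff v (g * h)%g = f (g * h)%g.
  apply: val_inj; apply: (act_inj (g := (g * h)%g)).
  have := vw [set (g * h)%g | h in D]; rewrite proj_translate /w !e; apply.
  by exists g.
rewrite coeff_equi// fE// => /(congr1 val).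
rewrite !(val_sub_map setwise_fixed _ (setwiseV Dh)) => /act_inj.
exact: val_inj.
Qed.

Lemma fixed_rep_Ind : iso_to_Ind fixed_rep pi.
Proof.
exists coeff; split=> [a u v x||v|g v].
- apply: val_inj; rewrite valL !val_to_sub linearP.
  exact: proj_linear hA _ _ _.
- exact: coeff_range.
- exact: ind_sqnorm_coeff.
- by apply/funext => x; rewrite /ind_action /coeff invgM invgK actM.
Qed.

End Induced.

Section IrreducibleInduced.
Variables (R : realType) (Delta : set R) (U : metricType R).
Hypotheses (hDelta : distance_set Delta) (hU : urysohn Delta U).
Variable pi : unitary_rep [set: selfisom U].
Local Notation V := (rep_space pi).

Lemma setT_inv : invariant_subspace [set: V].
Proof. by split=> //; split=> //; exact: closedT. Qed.

(** The translates of the fixed vectors of a dissociated [A] are orthogonal and, by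
    irreducibility, total. The inducing representation is irreducible because an
    invariant [L] is recovered from its orbit span, which is the whole space. *)
Lemma irreducible_induced : irreducible pi ->
  exists (A : set U) (sigma : unitary_rep (setwise_stabilizer A)),
      [/\ finite_set A, irreducible sigma,
          trivial_on sigma (pointwise_stabilizer A) & iso_to_Ind sigma pi].
Proof.
move=> [[v0 v00] irr].
have [|A [[v [_ hv v_neq0]] dA]] := exists_dissociated hDelta hU setT_inv.
  by exists v0.
have spanT (L : set V) x : L x -> x != 0 -> orbit_span L = setT.
  move=> Lx x0; case: (irr _ (orbit_span_inv L)) => // e.
  by have := sub_orbit_span Lx; rewrite e => x0'; rewrite x0' eqxx in x0.
exists [set x | x \in A], (fixed_rep pi A); split.
- exact: finite_seq.
- apply: subrep_irreducible => [|L hL LA Linv]; first by exists v.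
  have [[x Lx x0]|h] := pselect (exists2 x, L x & x != 0); last first.
    by left=> x Lx; apply: contrapT => /eqP x0; apply: h; exists x.
  right=> y hy; apply: (orbit_span_fixed setT_inv dA hL) => //.
  + by move=> z Lz; split=> //; exact: LA.
  + by move=> g; rewrite -setwise_stabilizerE; exact: Linv.
  + by split=> //; rewrite (spanT _ _ Lx x0).
- exact: fixed_rep_trivial.
- apply: fixed_rep_Ind => // y hy; apply: sqnorm_eq0; rewrite -ip_sqnorm.
  have : orbit_span (fixed A) y by rewrite (spanT _ _ hv v_neq0).
  by move=> /perp_ip; exact.
Qed.

End IrreducibleInduced.

(** * Decomposition into irreducible representations *)

Section OrthFamilies.
Variables (R : realType) (V : hilbertType R).
Implicit Types (L : set V) (xs : seq V).

(** Counting orthogonal families replaces the dimension. *)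
Definition orth_family L n := exists y : nat -> V,
  (forall i, (i < n)%N -> L (y i) /\ y i != 0) /\
  (forall i j, (i < n)%N -> (j < n)%N -> i != j -> ip (y i) (y j) = 0).

Lemma orth_family0 L : orth_family L 0.
Proof. by exists (fun=> 0); split. Qed.

Lemma orth_family_cons L L' z n : L' `<=` L -> L z -> z != 0 ->
  (forall x, L' x -> ip z x = 0) -> orth_family L' n -> orth_family L n.+1.
Proof.
move=> LL Lz z0 zL [y [yL yo]].
exists (fun i => if i is i'.+1 then y i' else z); split=> [[|i]//|[|i] [|j]//].
- by move=> /yL[/LL].
- by move=> _ /yL[/zL].
- by move=> /yL[/zL h _] _ _; rewrite ipC.
- by move=> hi hj ij; apply: yo.
Qed.

(** Among more than [size xs] real coefficients some nonzero ones make the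
    combination of the family orthogonal to all of [xs], hence zero. *)
Lemma orth_family_bound L xs : closed_subspace L ->
  (forall y, L y -> (forall x, x \in xs -> ip y x = 0) -> y = 0) ->
  ~ orth_family L (size xs).+1.
Proof.
move=> hL totL [y [yL yo]].
pose M : 'M[R]_((size xs).+1, size xs) := \matrix_(i, j) ip (y i) (nth 0 xs j).
pose c := nz_row (kermx M).
have c0 : c != 0.
  rewrite nz_row_eq0 -mxrank_eq0 mxrank_ker subn_eq0 -ltnNge ltnS.
  exact: rank_leq_col.
have cM : c *m M = 0 by apply/sub_kermxP; exact: nz_row_sub.
pose v := \sum_(i < (size xs).+1) (c 0 i)%:C *: y i.
have ipv x : ip v x = \sum_(i < (size xs).+1) c 0 i * ip (y i) x.
  by rewrite ipC ip_sumr; apply: eq_bigr => i _; rewrite ipZr ipC.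
have Lv : L v.
  rewrite /v; elim/big_ind: _ => [|u w Lu Lw|i _]; first exact: subspace0.
    exact: subspaceD.
  by apply: subspaceZ => //; have [] := yL i (ltn_ord i).
have v0 : v = 0.
  apply: totL => // x xxs; rewrite ipv.
  have jx : (index x xs < size xs)%N by rewrite index_mem.
  have := congr1 (fun N : 'rV[R]_(size xs) => N 0 (Ordinal jx)) cM.
  rewrite !mxE => e; rewrite -[RHS]e; apply: eq_bigr => i _.
  by rewrite mxE /= nth_index.
move/eqP: c0; apply; apply/rowP => k; rewrite mxE.
have := ipv (y k); rewrite v0 ip0l (bigD1 k)//= big1 => [|i ik].
  rewrite addr0 ip_sqnorm => /esym/eqP; rewrite mulf_eq0 => /orP[/eqP//|/eqP].
  by move=> /sqnorm_eq0 yk; have [_] := yL k (ltn_ord k); rewrite yk eqxx.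
by rewrite (yo i k) ?mulr0.
Qed.

End OrthFamilies.

Section Words.
Variable T : eqType.

Fixpoint words_over (s : seq T) n : seq (seq T) :=
  if n is n'.+1 then [seq x :: w | x <- s, w <- words_over s n'] else [:: [::]].

Lemma mem_words_over (s w : seq T) : {subset w <= s} -> w \in words_over s (size w).
Proof.
elim: w => //= x w IH h; apply/allpairsP; exists (x, w) => /=; split=> //.
  by apply: h; rewrite mem_head.
by apply: IH => y yw; apply: h; rewrite inE yw orbT.
Qed.
End Words.

Section Decomposition.
Variables (R : realType) (Delta : set R) (U : metricType R).
Hypotheses (hDelta : distance_set Delta) (hU : urysohn Delta U).
Variable pi : unitary_rep [set: selfisom U].
Local Notation V := (rep_space pi).
Implicit Types (L M W : set V) (A : seq U).

Definition sstab_inv A L :=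
  closed_subspace L /\ forall g, sstab A g -> forall v, L v -> L (pi g v).

(** The vector [pi g v] only depends on [map g A], a word over [A]. *)
Lemma finite_orbit A v : fixed A v ->
  exists xs : seq V, forall g, sstab A g -> pi g v \in xs.
Proof.
move=> hv.
have /choice[f hf] (w : seq U) :
    exists x, forall g, sstab A g -> map g A = w -> pi g v = x.
  have [[g [gA <-]]|h] := pselect (exists g, sstab A g /\ map g A = w).
    exists (pi g v) => k kA kg; apply: (act_inj (g := (g^-1)%g)).
    rewrite actVK -actM; apply: hv => a aA; rewrite selfisomME.
    have : nth a (map k A) (index a A) = nth a (map g A) (index a A) by rewrite kg.
    by rewrite !(nth_map a) ?index_mem// nth_index// => ->; rewrite selfisomVK.
  by exists 0 => g gA gw; case: h; exists g.
exists (map f (words_over A (size A))) => g gA; rewrite (hf _ g gA erefl).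
apply: map_f; rewrite -(size_map g); apply: mem_words_over => x.
by rewrite sstab_map.
Qed.

Lemma sstab_span_inv A v :
  sstab_inv A (cspan [set pi g v | g in sstab A]).
Proof.
split=> [|g gA x hx y a hy]; first exact: cspan_closed.
rewrite ip_actl linearZ; apply: hx => _ b [h hA <-].
rewrite ip_actl invgK linearZ -actM; apply: hy; exists (g * h)%g => //.
by move=> c cA; exact/gA/hA.
Qed.

(** The setwise stabilizer acts on [K] through a finite group, so the span [L0] of an
    orbit contains orthogonal families of bounded size only. An invariant subspace
    with the smallest strict bound is irreducible: a proper nonzero subspace has a
    smaller one, as a vector orthogonal to it can be added to its families. *)
Lemma exists_sstab_irreducible A K : sstab_inv A K -> K `<=` fixed A ->
  (exists2 v, K v & v != 0) ->
  exists L, [/\ sstab_inv A L, L `<=` K, exists2 v, L v & v != 0 &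
    forall L', sstab_inv A L' -> L' `<=` L -> L' `<=` [set 0] \/ L `<=` L'].
Proof.
move=> [hK gK] KA [v Kv v0].
pose Q n := `[< exists L, [/\ sstab_inv A L, L `<=` K, exists2 v, L v & v != 0 &
  ~ orth_family L n] >].
have exQ : exists n, Q n.
  have [xs hxs] := finite_orbit (KA _ Kv).
  (* the bound counts real combinations, hence the multiples by i *)
  pose ys := xs ++ [seq 'i%C *: x | x <- xs].
  pose L0 := cspan [set pi g v | g in sstab A].
  exists (size ys).+1; apply/asboolP; exists L0; split.
  - exact: sstab_span_inv.
  - by apply: cspan_min => // _ [g gA <-]; exact: gK.
  - by exists v => //; apply: sub_cspan; exists 1%g; rewrite ?act1// => a; rewrite selfisom1E.
  apply: orth_family_bound => [|y Ly hy]; first exact: cspan_closed.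
  apply: sqnorm_eq0; rewrite -ip_sqnorm; apply: (perp_ip Ly) => _ a [g gA <-].
  have gxs := hxs _ gA; rewrite (complexE a) scalerDl ipDr ipZr.
  rewrite ['i%C * _]mulrC -scalerA ipZr !hy ?mulr0 ?addr0// mem_cat ?gxs//.
  by rewrite (map_f (fun x => 'i%C *: x)) ?orbT.
have := ex_minnP exQ => -[n /asboolP[L [iL LK Lnz Ln]] nmin].
exists L; split=> // L' iL' L'L.
have [[w L'w w0]|h] := pselect (exists2 x, L' x & x != 0); last first.
  by left=> x Lx; apply: contrapT => /eqP x0; apply: h; exists x.
right=> y Ly; apply: contrapT => L'y.
have [hL' gL'] := iL'; have [hL gL] := iL.
pose z := y - proj L' y.
have z0 : z != 0.
  by apply/eqP => /eqP; rewrite subr_eq0 => /eqP e; apply: L'y; rewrite e; exact: proj_in.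
case: n Ln nmin => [|n] Ln nmin; first by apply: Ln; exact: orth_family0.
apply: Ln; apply: (orth_family_cons L'L (z := z)) => //.
- by apply: (subspaceB hL) => //; exact: (L'L _ (proj_in hL' y)).
- exact: (projP hL' y).2.
apply: contrapT => L'n; have : Q n.
  by apply/asboolP; exists L'; split=> //; [exact: subset_trans LK|exists w].
by move=> /nmin; rewrite ltnn.
Qed.

Definition irreducible_subspace M := [/\ invariant_subspace M, exists2 v, M v & v != 0 &
  forall L, invariant_subspace L -> L `<=` M -> L `<=` [set 0] \/ M `<=` L].

(** For [A] dissociated, the orbit span of an irreducible space [L] of vectors
    fixed by [stab A] is irreducible: an invariant subspace [L2] of it either contains
    [L], or meets [L] in 0; then the vectors of [L2] have no component fixed by
    [stab A], and [L2] is orthogonal to the translates of [L]. *)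
Lemma exists_irreducible_subspace W : invariant_subspace W -> (exists2 v, W v & v != 0) ->
  exists2 M, M `<=` W & irreducible_subspace M.
Proof.
move=> iW Wnz; have [hW gW] := iW.
have [A [[v [Wv hv v0]] dA]] := exists_dissociated hDelta hU iW Wnz.
have hA := fixed_closed pi A.
have [|||L [iL LK [x Lx x0] irrL]] := @exists_sstab_irreducible A (W `&` fixed A).
- split; last first.
    by move=> g gA y [Wy hy]; split; [exact: gW|exact: fixed_sstab].
  split; first by split; exact: subspace0.
    by move=> a y z [Wy hy] [Wz hz]; split; [exact: (subspaceL hW)|exact: (subspaceL hA)].
  by apply: closedI; [case: hW|case: hA].
- by move=> y [].
- by exists v.
have LW : L `<=` W by move=> y /LK[].
have MA := orbit_span_fixed iW dA iL.1 LK iL.2.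
exists (orbit_span L); first exact: orbit_span_min.
split; [exact: orbit_span_inv|by exists x => //; exact: sub_orbit_span|].
move=> L2 iL2 L2M; have [hL2 gL2] := iL2.
have [|y []//|h|h] := irrL (L2 `&` L).
- split; last first.
    by move=> g gA y [L2y Ly]; split; [exact: gL2|exact: iL.2].
  split; first by split; [exact: subspace0|exact: (subspace0 iL.1)].
    by move=> a y z [? ?] [? ?]; split; [exact: (subspaceL hL2)|exact: (subspaceL iL.1)].
  by apply: closedI; [case: hL2|case: iL.1].
- left=> w L2w.
  have P0 u : L2 u -> proj (fixed A) u = 0.
    move=> L2u; apply: h; split; first exact: proj_fixed_inv.
    apply: MA; split; last exact: proj_fixed.
    by apply: L2M; exact: proj_fixed_inv.
  apply: sqnorm_eq0; rewrite -ip_sqnorm; apply: (perp_ip (L2M _ L2w)).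
  move=> _ a [g _ [y Ly <-]]; rewrite -linearZ ipC ip_actl ipC.
  have L2g : L2 (pi (g^-1)%g w) by exact: gL2.
  have [_ hay] := LK _ (subspaceZ iL.1 a Ly).
  by rewrite -(proj_ipl hA)// P0// ip0l.
- by right; apply: orbit_span_min => // y /h[].
Qed.

Definition orth_collection (F : set (set V)) := (forall M, F M -> irreducible_subspace M) /\
  forall M N, F M -> F N -> M != N -> forall x y, M x -> N y -> ip x y = 0.

(** Zorn's lemma: if the orthogonal of a maximal collection were not 0, it would
    contain one more irreducible subspace. *)
Lemma exists_maximal_collection : exists F, orth_collection F /\
  forall v, (forall M x, F M -> M x -> ip v x = 0) -> v = 0.
Proof.
have [G Gorth Gtot|F [[Firr Forth] Fmax]] := @Zorn_bigcup _ orth_collection.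
  split=> [M [F GF FM]|M N [F GF FM] [F' GF' FN] MN].
    exact: (Gorth _ GF).1.
  have [FF'|F'F] := Gtot _ _ GF GF'.
    by apply: (Gorth _ GF').2 => //; exact: FF'.
  by apply: (Gorth _ GF).2 => //; exact: F'F.
exists F; split=> // v hv; apply: contrapT => /eqP v0.
pose W := perp (\bigcup_(M in F) M).
have FZ M (a : R[i]) x : F M -> M x -> M (a *: x).
  by move=> /Firr[[hM _] _ _]; exact: subspaceZ.
have iW : invariant_subspace W.
  split=> [|g _ x hx y a [M FM My]]; first exact: perp_closed.
  rewrite ip_actl linearZ; apply: hx; exists M => //.
  by have [[_ gM] _ _] := Firr _ FM; exact: gM.
have Wv : W v by move=> y a [M FM My]; apply: (hv M) => //; exact: FZ.
have [M MW Mirr] : exists2 M, M `<=` W & irreducible_subspace M.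
  by apply: exists_irreducible_subspace => //; exists v.
have MF N x y : F N -> M x -> N y -> ip x y = 0.
  by move=> FN Mx Ny; apply: (perp_ip (MW _ Mx)); exists N.
apply: (Fmax (F `|` [set M])).
  split; first exact: subsetUl.
  move=> /(_ M (or_intror erefl)) FM.
  have [_ [x Mx x0] _] := Mirr; move/eqP: x0; apply; apply: sqnorm_eq0.
  by rewrite -ip_sqnorm; exact: (MF _ _ _ FM Mx Mx).
split=> [N [/Firr//|->//]|N N' [FN|->] [FN'|->] NN' x y Nx Ny].
- exact: (Forth _ _ FN FN' NN').
- by rewrite ipC; exact: (MF _ _ _ FN Ny Nx).
- exact: (MF _ _ _ FN' Nx Ny).
- by rewrite eqxx in NN'.
Qed.

(** The summands are the members of a maximal collection, which index themselves. *)
Lemma decomposition : exists (I : choiceType) (rho : I -> unitary_rep [set: selfisom U]),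
  (forall i, irreducible (rho i)) /\ iso_to_sum rho pi.
Proof.
have [F [[Firr Forth] Ftot]] := exists_maximal_collection.
pose I : choiceType := {M : set V | M \in F}.
have FI (i : I) : F (val i) by exact/set_mem/(valP i).
have invI (i : I) : invariant_subspace (val i) by case: (Firr _ (FI i)).
have hI (i : I) : closed_subspace (val i) := (invI i).1.
pose rho (i : I) : unitary_rep [set: selfisom U] :=
  @subrep _ _ pi [set: selfisom U] (val i) (hI i) (fun g _ => Logic.I) (invI i).2.
have orthI (i j : I) x y : [set: I] i -> [set: I] j -> i != j ->
    val i x -> val j y -> ip x y = 0.
  by move=> _ _ ij; apply: Forth => //; rewrite (inj_eq val_inj).
have totI v : (forall (i : I) x, [set: I] i -> val i x -> ip v x = 0) -> v = 0.
  move=> h; apply: Ftot => M x FM Mx.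
  exact: (h (exist _ M (mem_set FM))).
have hI' (i : I) : [set: I] i -> closed_subspace (val i) by move=> _; exact: hI.
have pars := parseval hI' orthI totI.
exists I, rho; split=> [i|].
  apply: subrep_irreducible => [|L hL Li Linv].
    by have [_ [x ? ?] _] := Firr _ (FI i); exists x.
  by have [_ _] := Firr _ (FI i); apply.
exists (fun v i => to_sub (hI i) v); split=> [a u v i||v|g v i _].
- apply: val_inj; rewrite valL !val_to_sub.
  exact: (proj_linear (hI i)).
- apply/seteqP; split=> [_ [v _ <-] /=|w wfin /=].
    by rewrite [X in (X < _)%E](_ : _ = (sqnorm v)%:E) ?ltry// -pars.
  have [v [vw _]] := hilbert_sum_surj hI' orthI (w := fun i => val (w i))
    (fun i _ => val_in (w i)) wfin.
  exists v => //; apply: functional_extensionality_dep => i.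
  by apply: val_inj; rewrite val_to_sub vw.
- by rewrite -pars.
- apply: val_inj; rewrite (val_sub_map (invI i).2)// !val_to_sub.
  by rewrite proj_inv.
Qed.

End Decomposition.

Theorem theorem1p1 (R : realType) (Delta : set R) (U : metricType R)
    (hDelta : distance_set Delta) (hU : urysohn Delta U) :
  (forall pi : unitary_rep [set: selfisom U], irreducible pi ->
    exists (A : set U) (sigma : unitary_rep (setwise_stabilizer A)),
      [/\ finite_set A, irreducible sigma,
          trivial_on sigma (pointwise_stabilizer A) & iso_to_Ind sigma pi]) /\
  (forall pi : unitary_rep [set: selfisom U],
    exists (I : choiceType) (rho : I -> unitary_rep [set: selfisom U]),
      (forall i, irreducible (rho i)) /\ iso_to_sum rho pi).
Proof.
split=> pi; first exact: irreducible_induced hDelta hU pi.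
exact: decomposition hDelta hU pi.
Qed.
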